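(* There is $\gamma_0>0$ such that, for the family described in the context with $0\le\gamma<\gamma_0$, for each $t>0$ and $\xi\in\mathbb T^2$, $$D_\xi\phi_{\gamma,t}=V_\gamma(\phi_{\gamma,t}(\xi))\otimes V_\gamma(\xi)+a_\gamma(\xi,t)\,V_\gamma(\phi_{\gamma,t}(\xi))\otimes V_\gamma^\perp(\xi)+b_\gamma(\xi,t)\,V_\gamma^\perp(\phi_{\gamma,t}(\xi))\otimes V_\gamma^\perp(\xi),$$ where, for some $C_0,b_*,t_*>0$ and all $t\ge t_*$, $$C_0\,t^{-b_*\gamma}\le b_\gamma(\xi,t)\le C_0^{-1}t^{b_*\gamma},\qquad |a_\gamma(\xi,t)|\le\gamma\,C_0^{-1}\,t^{1+b_*\gamma}.$$ Moreover, provided $\gamma>0$ is small enough, for generic $\varphi$ there exists $c_*>0$ such that $$\sup_{x\in\mathbb T^2}\limsup_{t\to\infty}\,b_\gamma(x,t)\,t^{-c_*\gamma^2}=\infty.$$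
   Context: Fix $\varphi\in C^\infty(\mathbb T,\mathbb R)$ with $\int_{\mathbb T}\varphi=0$. For small $\gamma\ge0$ the map $F_\gamma(x,y)=(2x+y-\gamma\varphi(x),\,x+y-\gamma\varphi(x))$ of $\mathbb T^2=\mathbb R^2/\mathbb Z^2$ is Anosov; $V_\gamma$ is the unit vector field, with positive first component, spanning the stable distribution of $F_\gamma$ (it is $C^{1+\alpha}$ for some $\alpha\in(0,1)$), and $\phi_{\gamma,t}$ is the flow generated by $V_\gamma$. For a vector $(a,b)$, $(a,b)^\perp=(-b,a)$; $(v\otimes w)u=\langle w,u\rangle v$. ''Generic'' means generic in the $C^2$ topology in the set $\{\|\varphi\|_{C^2}<1\}$. *)

(* Defs.v *)
From HB Require Import structures.
From mathcomp Require Import all_boot all_order all_algebra.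
From mathcomp Require Import all_classical all_reals all_analysis.

Set Implicit Arguments.
Unset Strict Implicit.
Unset Printing Implicit Defensive.

Import Order.TTheory GRing.Theory Num.Theory.
Import numFieldNormedType.Exports.

Local Open Scope classical_set_scope.
Local Open Scope ring_scope.

(* Objects on T = R/Z and T^2 = R^2/Z^2 are represented by their lifts:
   functions on T by 1-periodic functions, vector fields on T^2 by Z^2-periodic
   maps R * R -> R * R, and maps and flows of T^2 by their lifts to R * R (same
   differentials).  The norm carried by R * R in the library is the sup norm;
   differentials do not depend on this choice, but unit vectors do, whence the
   explicit Euclidean structure below. *)

Section Plane.
Variable R : realType.
Implicit Types (u v w p : R * R).

Definition dot u v : R := u.1 * v.1 + u.2 * v.2.

Definition enorm v : R := Num.sqrt (dot v v).

Definition perp v : R * R := (- v.2, v.1).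

Definition tens v w u : R * R := dot w u *: v.

Definition periodic2 (T : Type) (f : R * R -> T) :=
  forall p (m n : int), f (p.1 + m%:~R, p.2 + n%:~R) = f p.

End Plane.

Section Observables.
Variable R : realType.
Implicit Types (phi psi : R -> R).

Definition smooth_zero_mean phi :=
  [/\ forall x, phi (x + 1) = phi x,
      forall (n : nat) x, derivable (derive1n n phi) x 1 &
      (\int[lebesgue_measure]_(x in `[0%R, 1%R]) (phi x)%:E = 0)%E].

Definition C2norm phi : R :=
  \big[Num.max/0]_(k < 3) sup [set `|derive1n k phi x| | x in [set: R]].

Definition C2_unit_ball : set (R -> R) :=
  [set phi | smooth_zero_mean phi /\ C2norm phi < 1].

(* Genericity means holding on a C^2-open and C^2-dense subset of the ball.
   Open dense sets are used rather than residual ones because the smooth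
   functions, with the C^2 topology, are not a Baire space: they are the
   countable union of the closed nowhere dense sets {sup |phi'''| <= n}, so that
   every subset, even the empty one, would count as residual. *)
Definition C2_open (U : set (R -> R)) :=
  forall phi, U phi -> exists2 e : R, 0 < e &
    forall psi, C2_unit_ball psi -> C2norm (psi \- phi) < e -> U psi.

Definition C2_dense (U : set (R -> R)) :=
  forall phi, C2_unit_ball phi -> forall e : R, 0 < e ->
    exists2 psi, U psi & C2norm (psi \- phi) < e.

Definition generic (P : set (R -> R)) :=
  exists U, [/\ U `<=` C2_unit_ball, C2_open U, C2_dense U & U `<=` P].

End Observables.

Section Dynamics.
Variable R : realType.

Definition Fmap (phi : R -> R) (gamma : R) (p : R * R) : R * R :=
  (2 * p.1 + p.2 - gamma * phi p.1, p.1 + p.2 - gamma * phi p.1).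

Definition subspace (E : set (R * R)) :=
  E 0 /\ forall (c : R) u v, E u -> E v -> E (c *: u + v).

Definition Anosov_splitting (F : R * R -> R * R)
    (Es Eu : R * R -> set (R * R)) :=
  [/\ periodic2 Es /\ periodic2 Eu,
      forall xi, subspace (Es xi) /\ subspace (Eu xi),
      forall xi, Es xi `&` Eu xi = [set 0] /\
        forall v, exists u w, [/\ Es xi u, Eu xi w & v = u + w],
      forall xi, 'd F xi @` Es xi = Es (F xi) /\
                 'd F xi @` Eu xi = Eu (F xi) &
      exists C lambda : R, [/\ 0 < C, 0 < lambda < 1 &
        forall xi (n : nat) v,
          (Es xi v -> enorm ('d (iter n F) xi v) <= C * lambda ^+ n * enorm v) /\
          (Eu xi v -> enorm v <= C * lambda ^+ n * enorm ('d (iter n F) xi v))]].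

Definition C1alpha (V : R * R -> R * R) :=
  (forall xi, differentiable V xi) /\
  exists alpha K : R, 0 < alpha < 1 /\
    forall xi zeta u,
      enorm ('d V xi u - 'd V zeta u) <= K * enorm (xi - zeta) `^ alpha * enorm u.

Definition stable_unit_field (F V : R * R -> R * R) :=
  [/\ forall xi, enorm (V xi) = 1,
      forall xi, 0 < (V xi).1,
      C1alpha V &
      exists Es Eu, Anosov_splitting F Es Eu /\
        forall xi, Es xi = [set c *: V xi | c in [set: R]]].

Definition flow_of (V : R * R -> R * R) (Phi : R -> R * R -> R * R) :=
  (forall xi, Phi 0 xi = xi) /\
  forall (t : R) xi, is_derive t 1 (fun s => Phi s xi) (V (Phi t xi)).

(* The left-hand side being a differential in the Frechet sense, differentiability
   of Phi t is part of the assertion; since (V xi, perp (V xi)) is orthonormal,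
   a and b are uniquely determined for t > 0. *)
Definition flow_differential (V : R * R -> R * R) (Phi : R -> R * R -> R * R)
    (a b : R * R -> R -> R) :=
  forall (t : R) xi, 0 < t ->
    is_diff xi (Phi t) (fun u =>
      tens (V (Phi t xi)) (V xi) u
      + a xi t *: tens (V (Phi t xi)) (perp (V xi)) u
      + b xi t *: tens (perp (V (Phi t xi))) (perp (V xi)) u).

End Dynamics.

(* Main.v *)
Require Import Defs.
From HB Require Import structures.
From mathcomp Require Import all_boot all_order all_algebra.
From mathcomp Require Import all_classical all_reals all_analysis.
From mathcomp Require Import ring lra.
Import Order.TTheory GRing.Theory Num.Theory.
Import numFieldNormedType.Exports.
Local Open Scope classical_set_scope.
Local Open Scope ring_scope.
Set Implicit Arguments.
Unset Strict Implicit.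
Unset Printing Implicit Defensive.

(** Write V as a multiple of the field W = (1, - slope), and let kap be the
    factor by which the differential of F contracts W.  The determinant b of the
    differential of the flow is the exponential of the integral of div V.
    Differentiating the invariance of W under F shows that this integral
    telescopes: ln b(xi, t) = S_n(phi_t xi) - S_n(xi) + O(1), where S_n is the
    n-th Birkhoff sum of ln kap, once n is so large (n ~ ln t) that F^n shrinks
    the flow segment from xi to phi_t xi to bounded length.  As kap is within
    O(gamma) of the contracting eigenvalue lam of the linear map, the bounds on b
    follow, and a is the integral of b against the curvature of the flow lines,
    which is O(gamma).

    For the growth of b, the invariance of W also gives
    1 / kap + kap o F = 3 - gamma (phi' o F).  Averaging over the torus (over
    fine grids, which F almost preserves) and using the strict convexity of the
    left-hand side, the mean of ln kap exceeds ln lam by at least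
    c gamma^2 (phi x0 - phi 0)^2, so S_n(y_n) >= n (ln lam + d) for some y_n, where
    d is of order gamma^2 for every nonconstant phi.  On the other hand F is at
    bounded distance from its linear part, which forces S_n <= n ln lam + O(1)
    somewhere, and by compactness S_n(x) <= n (ln lam + d / 2) for one x and all
    n.  An unstable curve through y_n + Z^2 meets the flow line of x at a time t_n
    of exponential size in n, at which b(x, t_n) >= exp(n d / 2 - O(1)). *)

(** * Real analysis *)

(** The stable field is only C^{1+alpha}, so no estimate may use second derivatives of it. The
    bounds on [kap] and on the gradient of [slope] are drawn from invariance instead: each quantity
    satisfies an equation along F that contracts by a factor below 1/2 with a source of size gamma
    B, and any a priori bound, however crude, then yields an explicit one. In the same way,
    differentiability of the flow rests on uniform continuity of the gradient of V, not on a
    quadratic remainder.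

    The point at which b grows must not depend on time, whereas the points y_n of large Birkhoff sum
    vary with n; hence the detour through a single slow point x whose flow line reaches curves
    through every y_n. No unstable manifold is constructed: images of horizontal segments, which
    stay in a cone of slopes between 0 and 1, do the same work.

    The two halves differ in uniformity. In the first, gamma0 depends on phi through the bound B on
    phi' and phi''. In the second, B = 1 on the C^2 unit ball, so one threshold serves every phi and
    only the constant in the exponent depends on phi. *)

Section RealAnalysis.
Variable R : realType.

Lemma is_derive_continuous (f : R -> R) (t d : R) :
  is_derive t 1 f d -> {for t, continuous f}.
Proof.
by move=> df; apply: differentiable_continuous; apply/derivable1_diffP/ex_derive.
Qed.

Lemma is_derive_mvt (f f' : R -> R) (a b : R) : a <= b ->
  (forall t, a <= t <= b -> is_derive t 1 f (f' t)) ->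
  exists2 c, a <= c <= b & f b - f a = f' c * (b - a).
Proof.
move=> ab df.
have [||c cab ->] := @MVT_segment R f f' a b ab.
- by move=> x; rewrite in_itv/= => /andP[/ltW ax /ltW xb]; apply: df; rewrite ax.
- suff : {in `[a, b], forall x, derivable f x 1}.
    exact: derivable_within_continuous.
  by move=> x; rewrite in_itv/= => xab; have [] := df _ xab.
- by exists c.
Qed.

Lemma derive_ge0_le (f f' : R -> R) (a b : R) : a <= b ->
  (forall t, a <= t <= b -> is_derive t 1 f (f' t)) ->
  (forall t, a <= t <= b -> 0 <= f' t) -> f a <= f b.
Proof.
move=> ab df f'0; have [c cab e] := is_derive_mvt ab df.
by rewrite -subr_ge0 e mulr_ge0 ?subr_ge0 ?f'0.
Qed.

Lemma derive_le_le (f f' g g' : R -> R) (a b : R) : a <= b ->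
  (forall t, a <= t <= b -> is_derive t 1 f (f' t)) ->
  (forall t, a <= t <= b -> is_derive t 1 g (g' t)) ->
  (forall t, a <= t <= b -> f' t <= g' t) -> f b - f a <= g b - g a.
Proof.
move=> ab df dg fg.
have := @derive_ge0_le (g \- f) (g' \- f') a b ab; rewrite /=.
move=> H; suff : g a - f a <= g b - f b by lra.
apply: H => t tab; last by rewrite subr_ge0 fg.
have := df _ tab; have := dg _ tab => dg' df'; exact: is_deriveB.
Qed.

(** Freezing [f] to the left of [b] makes it continuous on the whole line, so the fundamental
    theorem applies. The margin between [a] and [b] keeps [b] itself a point of continuity. *)
Lemma antiderivative (f : R -> R) (a b c : R) : a < b ->
  (forall t, a < t -> {for t, continuous f}) ->
  exists F : R -> R, F c = 0 /\ forall t, b < t -> is_derive t 1 F (f t).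
Proof.
move=> ab cf.
pose g t := f (Num.max b t).
have cg t : {for t, continuous g}.
  apply: (@continuous_comp _ _ _ (fun t => Num.max b t) f).
    by apply: continuous_max; [exact: cvg_cst|exact: cvg_id].
  by apply: cf; rewrite lt_max ab.
pose G t := (\int[lebesgue_measure]_(x in `[b, t]) g x)%R.
exists (fun t => G t - G c); split; first by rewrite subrr.
move=> t bt.
have [||||d e] := @continuous_FTC1_closed R g b t (t + 1) _ _ _ _.
- by rewrite ltrDl.
- apply: continuous_compact_integrable; first exact: segment_compact.
  by apply: continuous_subspaceT => x; exact: cg.
- exact: bt.
- exact: cg.
have dG : is_derive t 1 G (g t) by split; [exact: d|rewrite -derive1E].
have -> : f t = g t - 0 by rewrite subr0 /g max_r// ltW.
exact: is_deriveB.
Qed.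

Lemma is_derive_cvg (V : normedModType R) (f : R -> V) (t : R) (d : V) :
  is_derive t 1 f d <->
  (fun h => h^-1 *: (f (h + t) - f t)) @ 0^' --> d.
Proof.
have E : (fun h => h^-1 *: (f (h + t) - f t)) =
    (fun h => h^-1 *: ((f \o shift t) (h *: 1) - f t)).
  by apply/funext => h /=; rewrite [h *: 1]mulr1.
rewrite E; split=> [[df <-]//|df].
by split; [apply/cvg_ex; exists d|exact: cvg_lim].
Qed.

Lemma is_derive_fst (f : R -> R * R) (t : R) v :
  is_derive t 1 f v -> is_derive t 1 (fun s => (f s).1) v.1.
Proof.
move=> /is_derive_cvg df; apply/is_derive_cvg.
exact: (cvg_comp _ _ df cvg_fst).
Qed.

Lemma is_derive_snd (f : R -> R * R) (t : R) v :
  is_derive t 1 f v -> is_derive t 1 (fun s => (f s).2) v.2.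
Proof.
move=> /is_derive_cvg df; apply/is_derive_cvg.
exact: (cvg_comp _ _ df cvg_snd).
Qed.

Lemma is_derive_pair (f g : R -> R) (t a b : R) :
  is_derive t 1 f a -> is_derive t 1 g b ->
  is_derive t 1 (fun s => (f s, g s)) (a, b).
Proof.
move=> /is_derive_cvg df /is_derive_cvg dg; apply/is_derive_cvg.
exact: (cvg_pair df dg).
Qed.

Lemma is_diff_derive (f : R -> R) (t d : R) :
  is_derive t 1 f d -> is_diff t f (fun u => d * u).
Proof.
move=> [df <-].
split; first exact/derivable1_diffP.
by rewrite deriv1E// derive1E; apply/funext => u /=; rewrite [LHS]mulrC.
Qed.

Lemma is_diff_fst (p : R * R) : is_diff p (fun u : R * R => u.1) (fun u => u.1).
Proof.
have c : continuous (fst : R * R -> R) by move=> x; exact: cvg_fst.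
split.
  exact: (@linear_differentiable _ _ _ (fst : {linear (R * R)%type -> R})).
exact: (@diff_lin _ _ _ (fst : {linear (R * R)%type -> R})).
Qed.

Lemma is_diff_snd (p : R * R) : is_diff p (fun u : R * R => u.2) (fun u => u.2).
Proof.
have c : continuous (snd : R * R -> R) by move=> x; exact: cvg_snd.
split.
  exact: (@linear_differentiable _ _ _ (snd : {linear (R * R)%type -> R})).
exact: (@diff_lin _ _ _ (snd : {linear (R * R)%type -> R})).
Qed.

(* The library states the derivation rules for the ring operations on functions,
   which do not unify with lambda terms. *)
Lemma is_derive_const (a t : R) : is_derive t 1 (fun=> a) (0 : R).
Proof. exact: is_derive_cst. Qed.

Lemma is_derive_idfun (t : R) : is_derive t 1 (fun s : R => s) (1 : R).
Proof. exact: is_derive_id. Qed.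

Lemma is_derive_add (f g : R -> R) (t a b : R) :
  is_derive t 1 f a -> is_derive t 1 g b ->
  is_derive t 1 (fun s => f s + g s) (a + b).
Proof. by move=> df dg; exact: is_deriveD. Qed.

Lemma is_derive_sub (f g : R -> R) (t a b : R) :
  is_derive t 1 f a -> is_derive t 1 g b ->
  is_derive t 1 (fun s => f s - g s) (a - b).
Proof. by move=> df dg; exact: is_deriveB. Qed.

Lemma is_derive_opp (f : R -> R) (t a : R) :
  is_derive t 1 f a -> is_derive t 1 (fun s => - f s) (- a).
Proof. by move=> df; exact: is_deriveN. Qed.

Lemma is_derive_mul (f g : R -> R) (t a b : R) :
  is_derive t 1 f a -> is_derive t 1 g b ->
  is_derive t 1 (fun s => f s * g s) (a * g t + f t * b).
Proof.
move=> df dg; have := @is_deriveM R R f g t 1 a b df dg.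
by rewrite addrC (mulrC a).
Qed.

Lemma is_derive_scale (c : R) (f : R -> R) (t a : R) :
  is_derive t 1 f a -> is_derive t 1 (fun s => c * f s) (c * a).
Proof. by move=> df; have := is_derive_mul (is_derive_const c t) df; rewrite mul0r add0r. Qed.

Lemma is_derive_compose (g f : R -> R) (t a b : R) :
  is_derive (f t) 1 g b -> is_derive t 1 f a ->
  is_derive t 1 (fun s => g (f s)) (b * a).
Proof. by move=> dg df; exact: is_derive1_comp. Qed.

Lemma is_derive_inv (f : R -> R) (t a : R) : f t != 0 ->
  is_derive t 1 f a -> is_derive t 1 (fun s => (f s)^-1) (- a / f t ^+ 2).
Proof.
move=> f0 df; have := @is_deriveV R f t a 1 f0 df.
by rewrite [_ *: _]mulrC mulrN -mulNr.
Qed.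

Lemma is_derive_expR (f : R -> R) (t a : R) :
  is_derive t 1 f a -> is_derive t 1 (fun s => expR (f s)) (expR (f t) * a).
Proof. by move=> df; apply: is_derive_compose df. Qed.

Lemma is_derive_ln (f : R -> R) (t a : R) : 0 < f t ->
  is_derive t 1 f a -> is_derive t 1 (fun s => ln (f s)) (a / f t).
Proof.
by move=> f0 df; rewrite mulrC; apply: is_derive_compose df; exact: is_derive1_ln.
Qed.

(* Gradients are recorded through the chain rule along curves, a form that is
   stable under composition and needs no Frechet differentiability. *)
Definition has_grad (f fx fy : R * R -> R) :=
  forall (X Y : R -> R) (t x' y' : R),
    is_derive t 1 X x' -> is_derive t 1 Y y' ->
    is_derive t 1 (fun s => f (X s, Y s))
      (fx (X t, Y t) * x' + fy (X t, Y t) * y').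

Lemma has_grad_unique (f fx fy gx gy : R * R -> R) :
  has_grad f fx fy -> has_grad f gx gy -> forall p, fx p = gx p /\ fy p = gy p.
Proof.
move=> h1 h2 p.
have d1 : is_derive p.1 1 (fun s : R => s) (1 : R) by exact: is_derive_id.
have d2 : is_derive p.2 1 (fun s : R => s) (1 : R) by exact: is_derive_id.
have c2 (t : R) : is_derive t 1 (fun s : R => p.2) (0 : R) by exact: is_derive_cst.
have c1 (t : R) : is_derive t 1 (fun s : R => p.1) (0 : R) by exact: is_derive_cst.
have [_ e1] := h1 _ _ _ _ _ d1 (c2 p.1); have [_ e2] := h2 _ _ _ _ _ d1 (c2 p.1).
have [_ e3] := h1 _ _ _ _ _ (c1 p.2) d2; have [_ e4] := h2 _ _ _ _ _ (c1 p.2) d2.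
move: e1 e3; rewrite e2 e4 !mulr1 !mulr0 !addr0 !add0r.
by case: p {d1 d2 c1 c2 e2 e4}.
Qed.

Lemma has_grad_mvt (f fx fy : R * R -> R) : has_grad f fx fy -> forall p q,
  exists2 c, 0 <= c <= 1 &
    let z := (p.1 + c * (q.1 - p.1), p.2 + c * (q.2 - p.2)) in
    f q - f p = fx z * (q.1 - p.1) + fy z * (q.2 - p.2).
Proof.
move=> gf p q.
have dl (a b t : R) : is_derive t 1 (fun s => a + s * (b - a)) (b - a).
  have := is_derive_add (is_derive_const a t) (is_derive_mul (is_derive_idfun t) (is_derive_const (b - a) t)).
  by rewrite mul1r mulr0 addr0 add0r.
have [c c01] := is_derive_mvt ler01
  (fun t _ => gf _ _ t _ _ (dl p.1 q.1 t) (dl p.2 q.2 t)).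
rewrite !mul0r !mul1r !addr0 subr0 mulr1 !(addrC p.1) !(addrC p.2) !subrK => e.
exists c => //=; move: e; rewrite (addrC _ p.1) (addrC _ p.2).
by case: p q => [? ?] [? ?].
Qed.

Lemma has_grad_lip (f fx fy : R * R -> R) (K : R) : has_grad f fx fy ->
  (forall p, `|fx p| <= K) -> (forall p, `|fy p| <= K) ->
  forall p q, `|f p - f q| <= K * (`|p.1 - q.1| + `|p.2 - q.2|).
Proof.
move=> gf bx by_ p q; have [c _ /= ->] := has_grad_mvt gf q p.
rewrite [leRHS]mulrDr; apply: (le_trans (ler_normD _ _)).
by rewrite !normrM; apply: lerD; rewrite ler_wpM2r.
Qed.

(** The supremum s satisfies s <= s / 2 + G. The bound [B] only ensures that s is finite and
    disappears from the conclusion. *)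
Lemma sup_contraction (T : Type) (f : T -> R) (B G : R) :
  (forall x, f x <= B) ->
  (forall M, (forall x, f x <= M) -> forall x, f x <= M / 2 + G) ->
  forall x, f x <= 2 * G.
Proof.
move=> fB fG x.
have hs : has_sup (range f).
  by split; [exists (f x), x|exists B => _ [y _ <-]].
have fs y : f y <= sup (range f) by apply: ub_le_sup; [case: hs|exists y].
have : sup (range f) <= sup (range f) / 2 + G.
  by apply: ge_sup => [|_ [y _ <-]]; [case: hs|exact: fG].
have := fs x; lra.
Qed.

End RealAnalysis.

(** * The map and its stable field *)

(** Smallness enters only through the product [gamma * B]. The value 1/50 keeps [kap] between 1/4
    and 2/5 and [slope] between 3/2 and 9/5, and makes the gradient recursion contract. *)
Record small_perturbation (R : realType) (phi phi1 phi2 : R -> R) (gamma B : R)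
    : Prop := SmallPerturbation {
  per_phi : forall x, phi (x + 1) = phi x;
  d_phi : forall x : R, is_derive x 1 phi (phi1 x);
  d_phi1 : forall x : R, is_derive x 1 phi1 (phi2 x);
  phi1_le : forall x, `|phi1 x| <= B;
  phi2_le : forall x, `|phi2 x| <= B;
  gamma_ge0 : 0 <= gamma;
  gammaB_le : gamma * B <= 50^-1 }.

Section Map.
Variables (R : realType) (phi phi1 phi2 : R -> R) (gamma B : R).
Hypothesis sp : small_perturbation phi phi1 phi2 gamma B.

Notation F := (Fmap phi gamma).

Lemma periodic_int (T : Type) (f : R -> T) : (forall x, f (x + 1) = f x) ->
  forall x (m : int), f (x + m%:~R) = f x.
Proof.
move=> pf x m.
have N n y : f (y + n%:R) = f y.
  by elim: n => [|n ih]; rewrite ?addr0// -natr1 addrA pf.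
case: m => n; first by rewrite -pmulrn.
by rewrite NegzE mulrNz -[in RHS](subrK (n.+1%:R : R) x) N pmulrn.
Qed.

Lemma B_ge0 : 0 <= B.
Proof. exact: le_trans (normr_ge0 _) (phi1_le sp 0). Qed.

Lemma per_phi1 x : phi1 (x + 1) = phi1 x.
Proof.
have := @is_derive_compose _ phi (fun y => y + 1) x _ _ (d_phi sp (x + 1))
  (is_derive_add (is_derive_idfun x) (is_derive_const 1 x)).
rewrite (_ : (fun y => phi (y + 1)) = phi); last exact/funext/(per_phi sp).
by case=> _; rewrite addr0 mulr1 => <-; have [_ <-] := d_phi sp x.
Qed.

Lemma gphi1_le x : `|gamma * phi1 x| <= gamma * B.
Proof.
by rewrite normrM ger0_norm ?(gamma_ge0 sp)// ler_wpM2l ?(phi1_le sp)// (gamma_ge0 sp).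
Qed.

Lemma gphi2_le x : `|gamma * phi2 x| <= gamma * B.
Proof.
by rewrite normrM ger0_norm ?(gamma_ge0 sp)// ler_wpM2l ?(phi2_le sp)// (gamma_ge0 sp).
Qed.

Lemma gphi1_bounds x : - 50^-1 <= gamma * phi1 x <= 50^-1.
Proof. by rewrite -ler_norml (le_trans (gphi1_le x) (gammaB_le sp)). Qed.

Lemma F_shift p (m n : int) : F (p.1 + m%:~R, p.2 + n%:~R) =
  ((F p).1 + (2 * m + n)%:~R, (F p).2 + (m + n)%:~R).
Proof.
rewrite /Fmap /= (periodic_int (per_phi sp)) !intrD !intrM.
by congr (_, _); rewrite -?[(2%:~R)]/(2 : R); ring.
Qed.

Lemma iter_F_shift k (m n : int) : exists m' n' : int, forall p,
  iter k F (p.1 + m%:~R, p.2 + n%:~R) =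
  ((iter k F p).1 + m'%:~R, (iter k F p).2 + n'%:~R).
Proof.
elim: k => [|k [m' [n' ih]]]; first by exists m, n.
exists (2 * m' + n'), (m' + n') => p.
by rewrite !iterS ih F_shift.
Qed.

(** The linear part has determinant 1, so every integer translation of the image comes from one of
    the source; [m - n] and [2 * n - m] are the rows of the inverse matrix. *)
Lemma iter_F_unshift k (m n : int) : exists m' n' : int, forall p,
  iter k F (p.1 + m'%:~R, p.2 + n'%:~R) =
  ((iter k F p).1 + m%:~R, (iter k F p).2 + n%:~R).
Proof.
elim: k m n => [|k ih] m n; first by exists m, n.
have [m' [n' e]] := ih (m - n) (2 * n - m).
exists m', n' => p; rewrite !iterS e F_shift.
by congr (_ + _%:~R, _ + _%:~R); ring.
Qed.

Lemma periodic2_iter_F T (f : R * R -> T) k :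
  periodic2 f -> periodic2 (f \o iter k F).
Proof.
move=> pf p m n /=; have [m' [n' ->]] := iter_F_shift k m n.
by rewrite pf.
Qed.

Lemma F_inj : injective F.
Proof.
move=> [x y] [x' y'] [] /= e1 e2.
have ex : x = x'.
  by rewrite (_ : x = (2 * x + y - gamma * phi x) - (x + y - gamma * phi x));
     [rewrite e1 e2; ring|ring].
subst x'; congr (_, _); move: e2 => /addIr /addrI //.
Qed.

Lemma iter_F_inj n : injective (iter n F).
Proof. by elim: n => [//|n ih] p q /= /F_inj /ih. Qed.

Definition dF (p u : R * R) : R * R :=
  ((2 - gamma * phi1 p.1) * u.1 + u.2, (1 - gamma * phi1 p.1) * u.1 + u.2).

Lemma is_diff_F p : is_diff p F (dF p).
Proof.
have dx := is_diff_fst p; have dy := is_diff_snd p.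
have dphi := @is_diff_comp _ _ _ _ _ _ phi _ _ dx (is_diff_derive (d_phi sp p.1)).
have := is_diff_pair
  (is_diffB (is_diffD (is_diffD dx dx) dy) (is_diffZ gamma dphi))
  (is_diffB (is_diffD dx dy) (is_diffZ gamma dphi)).
set L := (X in is_diff _ X _); set D := (X in is_diff _ _ X).
have -> : L = F.
  apply/funext => q; rewrite /L /Fmap; congr (_, _).
  by rewrite mulr_natl.
suff -> : D = dF p by [].
apply/funext => u; rewrite /D /dF /=.
congr (_, _).
- by rewrite -[LHS]/(u.1 + u.1 + u.2 - gamma * (phi1 p.1 * u.1)); ring.
- by rewrite -[LHS]/(u.1 + u.2 - gamma * (phi1 p.1 * u.1)); ring.
Qed.

Lemma curve_F (X Y : R -> R) (t x' y' : R) :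
  is_derive t 1 X x' -> is_derive t 1 Y y' ->
  is_derive t 1 (fun s => (F (X s, Y s)).1) (dF (X t, Y t) (x', y')).1 /\
  is_derive t 1 (fun s => (F (X s, Y s)).2) (dF (X t, Y t) (x', y')).2.
Proof.
move=> dX dY; have dp := is_derive_scale gamma (is_derive_compose (d_phi sp (X t)) dX).
split.
- apply: (is_derive_eq (is_derive_sub (is_derive_add (is_derive_scale 2 dX) dY) dp)).
  by rewrite /=; ring.
- apply: (is_derive_eq (is_derive_sub (is_derive_add dX dY) dp)).
  by rewrite /=; ring.
Qed.

End Map.

(** * The stable direction and its contraction rate *)

Section StableField.
Variables (R : realType) (phi phi1 phi2 : R -> R) (gamma B : R).
Hypothesis sp : small_perturbation phi phi1 phi2 gamma B.
Variable V : R * R -> R * R.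
Hypothesis sV : stable_unit_field (Fmap phi gamma) V.

Notation F := (Fmap phi gamma).

Lemma V1_gt0 p : 0 < (V p).1. Proof. by case: sV. Qed.

Lemma V_unit p : (V p).1 ^+ 2 + (V p).2 ^+ 2 = 1.
Proof.
case: sV => /(_ p) + _ _ _; rewrite /enorm /dot -!expr2 => e.
have ge0 : 0 <= (V p).1 ^+ 2 + (V p).2 ^+ 2 by rewrite addr_ge0 ?sqr_ge0.
by rewrite -[LHS](sqr_sqrtr ge0) e expr1n.
Qed.

Lemma V1_le1 p : (V p).1 <= 1.
Proof. have := V_unit p; have := V1_gt0 p; nra. Qed.

Definition slope p := - (V p).2 / (V p).1.

(* dF p maps (1, - slope p) to kap p (1, - slope (F p)), see [dF_V], [slope_F]. *)
Definition kap p := 2 - gamma * phi1 p.1 - slope p.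

Lemma V2E p : (V p).2 = - slope p * (V p).1.
Proof. by rewrite /slope !mulNr opprK divfK// gt_eqF ?V1_gt0. Qed.

Lemma V_slope p : (V p).1 ^+ 2 * (1 + slope p ^+ 2) = 1.
Proof. by rewrite -[RHS](V_unit p) V2E; ring. Qed.

Lemma periodic2_V : periodic2 V.
Proof.
move=> p m n; case: sV => _ _ _ [Es [Eu [[[pEs _] _ _ _ _] EsV]]].
have : Es (p.1 + m%:~R, p.2 + n%:~R) (V (p.1 + m%:~R, p.2 + n%:~R)).
  by rewrite EsV; exists 1 => //; rewrite scale1r.
rewrite pEs EsV => -[c _ e].
have e1 : c * (V p).1 = (V (p.1 + m%:~R, p.2 + n%:~R)).1 by rewrite -e.
have e2 : c * (V p).2 = (V (p.1 + m%:~R, p.2 + n%:~R)).2 by rewrite -e.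
have := V_unit (p.1 + m%:~R, p.2 + n%:~R).
rewrite -e1 -e2 !exprMn -mulrDr V_unit mulr1 => /eqP.
rewrite sqrf_eq1 => /orP[/eqP c1|/eqP cN1]; first by rewrite -e c1 scale1r.
have := V1_gt0 (p.1 + m%:~R, p.2 + n%:~R); have := V1_gt0 p.
by rewrite -e1 cN1 => *; exfalso; clear e; lra.
Qed.

Lemma periodic2_slope : periodic2 slope.
Proof. by move=> p m n; rewrite /slope periodic2_V. Qed.

Lemma periodic2_kap : periodic2 kap.
Proof.
by move=> p m n; rewrite /kap periodic2_slope /= (periodic_int (per_phi1 sp)).
Qed.

Lemma dF_V p : dF phi1 gamma p (V p) =
  (kap p * (V p).1, (kap p - 1) * (V p).1).
Proof. by rewrite /dF V2E /kap; congr (_, _); ring. Qed.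

Lemma slope_F p : kap p * (1 + slope (F p)) = 1.
Proof.
case: sV => _ _ _ [Es [Eu [[_ _ _ /(_ p)[dE _] _] EsV]]].
have : Es (F p) ('d F p (V p)).
  by rewrite -dE; exists (V p) => //; rewrite EsV; exists 1 => //; rewrite scale1r.
have [_ ->] := is_diff_F sp p.
rewrite EsV dF_V => -[c _ [e1 e2]].
have h1 := V1_gt0 p.
suff : (kap p * (1 + slope (F p)) - 1) * (V p).1 = 0.
  by move/eqP; rewrite mulf_eq0 (gt_eqF h1) orbF subr_eq0 => /eqP.
rewrite [LHS](_ : _ = slope (F p) * (kap p * (V p).1) + (kap p - 1) * (V p).1); last by ring.
by rewrite -e1 -e2 /= V2E -![_ *: _]/(_ * _); ring.
Qed.

Lemma kap_rec p : kap p * (3 - gamma * phi1 (F p).1 - kap (F p)) = 1.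
Proof. by rewrite -[RHS](slope_F p) [kap (F p)]/kap; ring. Qed.

Lemma kap_neq0 p : kap p != 0.
Proof.
by apply/eqP => e; have := slope_F p; rewrite e mul0r => /eqP; rewrite eq_sym oner_eq0.
Qed.

Definition kprod n p := \prod_(k < n) kap (iter k F p).

Lemma kprodSr n p : kprod n.+1 p = kprod n p * kap (iter n F p).
Proof. exact: big_ord_recr. Qed.

Lemma diff_iter_F_V n p : exists df, is_diff p (iter n F) df /\
  df (V p) = (kprod n p * (V p).1, - slope (iter n F p) * (kprod n p * (V p).1)).
Proof.
elim: n => [|n [df [dfd dfV]]].
  exists id; split; first exact: is_diff_id.
  by rewrite /kprod big_ord0 mul1r -V2E -surjective_pairing.
exists (dF phi1 gamma (iter n F p) \o df); split.
  exact: (@is_diff_comp _ _ _ _ _ _ F _ _ dfd (is_diff_F sp _)).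
rewrite /= dfV kprodSr /dF /=; set q := iter n F p.
rewrite (_ : - slope (F q) * (kprod n p * kap q * (V p).1) =
   (- (kap q * (1 + slope (F q))) + kap q) * (kprod n p * (V p).1)); last by ring.
by rewrite slope_F /kap; congr (_, _); ring.
Qed.

Lemma kap_step p (c : R) : 0 < c -> c <= kap p -> 29 / 10 - c^-1 <= kap (F p).
Proof.
move=> c0 ck; have k0 := lt_le_trans c0 ck.
have e : 3 - gamma * phi1 (F p).1 - kap (F p) = (kap p)^-1.
  by apply: (mulfI (kap_neq0 p)); rewrite kap_rec divff ?kap_neq0.
have := gphi1_bounds sp (F p).1.
have : (kap p)^-1 <= c^-1 by rewrite lef_pV2.
by rewrite -e; lra.
Qed.

(** Contraction of stable vectors is used here. Along an orbit [kap] follows a perturbation of k ->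
    3 - 1/k, whose fixed points are [lam], repelling, and [1 / lam], attracting. A value of at least
    1/2 climbs past 9/10, 17/10 and 23/10 and remains there, so the products [kprod] grow and stable
    vectors would be expanded. *)
Lemma kap_lt_half p : kap p < 2^-1.
Proof.
rewrite ltNge; apply/negP => k0.
have k1 := kap_step (_ : 0 < 2^-1) k0; rewrite invrK in k1.
have {}k1 : 9 / 10 <= kap (F p) by apply: le_trans (k1 _); [lra|lra].
have k2 : 17 / 10 <= kap (iter 2 F p).
  by apply: le_trans (kap_step (_ : 0 < 9 / 10) k1); lra.
have k3 : 23 / 10 <= kap (iter 3 F p).
  by apply: le_trans (kap_step (_ : 0 < 17 / 10) k2); lra.
have k4 n : 23 / 10 <= kap (iter n F (iter 3 F p)).
  elim: n => [//|n ih].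
  by apply: le_trans (kap_step (_ : 0 < 23 / 10) ih); lra.
set q := iter 3 F p in k4.
have kn n : 1 + n%:R <= kprod n q.
  elim: n => [|n ih]; first by rewrite /kprod big_ord0 addr0.
  rewrite kprodSr -natr1; have := k4 n; have : 0 <= n%:R :> R by [].
  by move: ih; set a := n%:R; set b := kprod _ _; set c := kap _; nra.
case: sV => _ _ _ [Es [Eu [[_ _ _ _ [C [l [C0 l01 H]]]] EsV]]].
have hq := V1_gt0 q.
have kC n : kprod n q * (V q).1 <= C.
  have [df [[_ dfE] dfV]] := diff_iter_F_V n q.
  have [Hs _] := H q n (V q).
  have : Es q (V q) by rewrite EsV; exists 1 => //; rewrite scale1r.
  move/Hs; rewrite dfE dfV; case: sV => /(_ q) -> _ _ _; rewrite mulr1 => le1.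
  have le2 : C * l ^+ n <= C.
    by rewrite ger_pMr// exprn_ile1//; case/andP: l01 => /ltW ? /ltW.
  apply: le_trans le2; apply: le_trans le1; rewrite /enorm /dot /=.
  rewrite -[leLHS]ger0_norm -?sqrtr_sqr; last first.
    rewrite mulr_ge0 ?(ltW hq)//; apply: le_trans (kn n).
    by rewrite addr_ge0.
  by rewrite ler_wsqrtr// -!expr2 lerDl sqr_ge0.
have [n nC] : exists n : nat, C / (V q).1 < n%:R.
  exists (Num.truncn `|C / (V q).1|).+1.
  by rewrite (le_lt_trans (ler_norm _))// truncnS_gt.
have := kC n; have := kn n; move: nC; rewrite ltr_pdivrMr//.
by move: hq; set a := n%:R; set b := kprod _ _; nra.
Qed.

(** A negative value would make [kap (F p)] exceed 3 up to 1/50, against [kap_lt_half]. *)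
Lemma kap_gt0 p : 0 < kap p.
Proof.
rewrite lt_def kap_neq0 leNgt /=; apply/negP => k0.
have e : 3 - gamma * phi1 (F p).1 - kap (F p) = (kap p)^-1.
  by apply: (mulfI (kap_neq0 p)); rewrite kap_rec divff ?kap_neq0.
have : (kap p)^-1 < 0 by rewrite invr_lt0.
by rewrite -e; have := gphi1_bounds sp (F p).1; have := kap_lt_half (F p); lra.
Qed.

Lemma kap_ge p : 4^-1 < kap p.
Proof.
have := kap_rec p; have := kap_gt0 p; have := kap_gt0 (F p).
have := gphi1_bounds sp (F p).1.
by set a := gamma * _; set b := kap (F p); set c := kap p; nra.
Qed.

(* The contracting eigenvalue of the matrix [[2, 1], [1, 1]]. *)
Definition lam : R := (3 - Num.sqrt 5) / 2.

Lemma lamE : lam * (3 - lam) = 1.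
Proof.
have := @sqr_sqrtr R 5 (ler0n _ 5); rewrite /lam; set s := Num.sqrt 5.
by move=> e; apply: (@mulfI R 4) => //; rewrite -[RHS](_ : 9 - s ^+ 2 = _);
  [field|rewrite e; ring].
Qed.

Lemma lam_bounds : 38 / 100 < lam < 383 / 1000.
Proof.
have := @sqr_sqrtr R 5 (ler0n _ 5); have := sqrtr_ge0 (5 : R).
by rewrite /lam; set s := Num.sqrt 5; nra.
Qed.

(** Subtracting the fixed point equation of [lam] from the recursion [kap_rec] expresses
    [kap p - lam] through its value at [F p] with the factor [kap p * lam], at most 1/5. *)
Lemma kap_lam p : `|kap p - lam| <= 2 * (gamma * B / 5).
Proof.
apply: (@sup_contraction _ _ (fun p => `|kap p - lam|) 1).
  move=> q; rewrite ler_norml.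
  by have := kap_lt_half q; have := kap_gt0 q; have := lam_bounds; lra.
move=> M kM {}p.
have -> : kap p - lam = kap p * lam * (gamma * phi1 (F p).1 + (kap (F p) - lam)).
  transitivity (kap p * (lam * (3 - lam)) - lam * (kap p * (3 - gamma * phi1 (F p).1 - kap (F p)))).
    by rewrite lamE kap_rec !mulr1.
  by ring.
have kl : kap p * lam <= 5^-1.
  have := kap_lt_half p; have := kap_gt0 p; have := lam_bounds.
  by set a := kap p; set b := lam; nra.
have kl0 : 0 <= kap p * lam.
  by rewrite mulr_ge0 ?(ltW (kap_gt0 _))//; have := lam_bounds; lra.
rewrite normrM (ger0_norm kl0).
have := ler_normD (gamma * phi1 (F p).1) (kap (F p) - lam).
have := gphi1_le sp (F p).1; have := kM (F p).
have : 0 <= `|kap (F p) - lam| by [].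
have : 0 <= `|gamma * phi1 (F p).1 + (kap (F p) - lam)| by [].
move: kl kl0; set a := kap p * lam; set b := `|_ + _|; set c := `|_ - _|; set d := `|_|.
set e := gamma * B; nra.
Qed.

Lemma gammaB_ge0 : 0 <= gamma * B.
Proof. by rewrite mulr_ge0 ?(gamma_ge0 sp) ?(B_ge0 sp). Qed.

Lemma kap_le p : kap p <= 2 / 5.
Proof.
have := kap_lam p; rewrite ler_norml; have := gammaB_le sp; have := lam_bounds.
by lra.
Qed.

Lemma slope_bounds p : 3 / 2 < slope p < 9 / 5.
Proof.
have e : slope p = 2 - gamma * phi1 p.1 - kap p by rewrite /kap; ring.
by rewrite e; have := kap_ge p; have := kap_le p; have := gphi1_bounds sp p.1; lra.
Qed.

Lemma V1_gt p : 2 / 5 < (V p).1.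
Proof.
have := V_slope p; have := slope_bounds p; have := V1_gt0 p.
set h := (V p).1; set r := slope p => h0 /andP[r1 r2] e.
rewrite ltNge; apply/negP => h1.
have h2 : h ^+ 2 <= 4 / 25 by nra.
have r3 : r ^+ 2 <= 81 / 25 by nra.
have : 0 <= h ^+ 2 by exact: sqr_ge0.
nra.
Qed.

End StableField.

(** * Gradient of the stable slope *)

Section Gradient.
Variables (R : realType) (phi phi1 phi2 : R -> R) (gamma B : R).
Hypothesis sp : small_perturbation phi phi1 phi2 gamma B.
Variable V : R * R -> R * R.
Hypothesis sV : stable_unit_field (Fmap phi gamma) V.

Notation F := (Fmap phi gamma).
Notation slope := (slope V).
Notation kap := (kap phi1 gamma V).

Definition V2x p : R := ('d V p (1, 0)).2.
Definition V2y p : R := ('d V p (0, 1)).2.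

Lemma is_derive_V (X Y : R -> R) (t x' y' : R) :
  is_derive t 1 X x' -> is_derive t 1 Y y' ->
  is_derive t 1 (fun s => V (X s, Y s)) ('d V (X t, Y t) (x', y')).
Proof.
move=> dX dY; case: sV => _ _ [dV _] _.
have [dc dcE] := is_derive_pair dX dY.
have cd : differentiable (fun s => (X s, Y s)) t by apply/derivable1_diffP.
have fd' := dV (X t, Y t).
have fcd : differentiable (V \o (fun s => (X s, Y s))) t by exact: differentiable_comp.
split; first exact/derivable1_diffP.
rewrite -[LHS]/('D_1 (V \o (fun s => (X s, Y s))) t) deriveE// diff_comp//=.
by congr ('d V _ _); rewrite -dcE deriveE.
Qed.

Lemma diff_V_lin p (u : R * R) :
  'd V p u = u.1 *: 'd V p (1, 0) + u.2 *: 'd V p (0, 1).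
Proof.
rewrite -!linearZ -linearD; congr ('d V p _).
case: u => a b; rewrite -[RHS]/(a * 1 + b * 0, a * 0 + b * 1).
by rewrite !mulr1 !mulr0 addr0 add0r.
Qed.

Lemma grad_V2 : has_grad (fun p => (V p).2) V2x V2y.
Proof.
move=> X Y t x' y' dX dY.
apply: (is_derive_eq (is_derive_snd (is_derive_V dX dY))).
by rewrite diff_V_lin /= -![_ *: _]/(_ * _) /V2x /V2y mulrC [X in _ + X]mulrC.
Qed.

(** Differentiating the unit length relation gives dV1 = slope dV2, so the gradient of the second
    component determines the whole differential of V. *)
Lemma grad_V1 :
  has_grad (fun p => (V p).1) (fun p => slope p * V2x p) (fun p => slope p * V2y p).
Proof.
move=> X Y t x' y' dX dY.
have d1 := is_derive_fst (is_derive_V dX dY).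
have d2 := grad_V2 dX dY.
apply: (is_derive_eq d1); set a := _.1 in d1 *; set b := _ + _ in d2.
suff : a = slope (X t, Y t) * b by move=> ->; rewrite /b; ring.
have := is_derive_add (is_derive_mul d1 d1) (is_derive_mul d2 d2).
rewrite (_ : (fun s => _) = fun=> 1); last first.
  by apply/funext => s; rewrite -!expr2 (V_unit sV).
case=> _; rewrite -[LHS]derive1E derive1_cst (V2E sV).
have := V1_gt0 sV (X t, Y t); set h := (V _).1 => h0 e.
apply: (@mulfI _ (2 * h)); first by rewrite mulf_neq0 ?gt_eqF.
by apply: subr0_eq; apply: (etrans _ (esym e)); ring.
Qed.

Lemma grad_slope : has_grad slope
  (fun p => - V2x p / (V p).1 ^+ 3) (fun p => - V2y p / (V p).1 ^+ 3).
Proof.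
move=> X Y t x' y' dX dY.
have d1 := grad_V1 dX dY; have d2 := grad_V2 dX dY.
have h0 : (V (X t, Y t)).1 != 0 by rewrite gt_eqF// (V1_gt0 sV).
apply: (is_derive_eq (is_derive_mul (is_derive_opp d2) (is_derive_inv h0 d1))).
rewrite (V2E sV) /=; have := V_slope sV (X t, Y t).
move: h0; set h := (V _).1; set r := slope _; set u := V2x _; set v := V2y _ => h0 e.
rewrite (_ : _ + _ = - (h ^+ 2 * (1 + r ^+ 2)) * (u * x' + v * y') / h ^+ 3); last by field.
by rewrite e; field.
Qed.

Definition slope_x p := - V2x p / (V p).1 ^+ 3.
Definition slope_y p := - V2y p / (V p).1 ^+ 3.

Lemma grad_kap : has_grad kap
  (fun p => - (gamma * phi2 p.1) - slope_x p) (fun p => - slope_y p).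
Proof.
move=> X Y t x' y' dX dY.
apply: (is_derive_eq (is_derive_sub (is_derive_sub (is_derive_const 2 t)
  (is_derive_scale gamma (is_derive_compose (d_phi1 sp (X t)) dX))) (grad_slope dX dY))).
by rewrite -/(slope_x _) -/(slope_y _) /=; ring.
Qed.

(** Both [slope \o F] and [1 / kap - 1] are the same function; the chain rule gives one gradient for
    it, [grad_kap] the other, and equating them yields the recursion. *)
Lemma grad_slope_rec p :
  slope_x p = kap p ^+ 2 * ((2 - gamma * phi1 p.1) * slope_x (F p) +
                            (1 - gamma * phi1 p.1) * slope_y (F p))
              - gamma * phi2 p.1 /\
  slope_y p = kap p ^+ 2 * (slope_x (F p) + slope_y (F p)).
Proof.
have k0 q : kap q != 0 by exact: (kap_neq0 sp sV).
have gl : has_grad (fun p => slope (F p))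
  (fun p => (2 - gamma * phi1 p.1) * slope_x (F p) +
            (1 - gamma * phi1 p.1) * slope_y (F p))
  (fun p => slope_x (F p) + slope_y (F p)).
  move=> X Y t x' y' dX dY; have [dFX dFY] := curve_F sp dX dY.
  by apply: (is_derive_eq (grad_slope dFX dFY)); rewrite /dF /=
    -/(slope_x _) -/(slope_y _); ring.
have gr : has_grad (fun p => (kap p)^-1 - 1)
  (fun p => (gamma * phi2 p.1 + slope_x p) / kap p ^+ 2)
  (fun p => slope_y p / kap p ^+ 2).
  move=> X Y t x' y' dX dY.
  apply: (is_derive_eq (is_derive_sub (is_derive_inv (f := fun s => kap (X s, Y s)) (k0 _) (grad_kap dX dY)) (is_derive_const 1 t))).
  by rewrite /=; field; rewrite k0.
have E : (fun p => slope (F p)) = (fun p => (kap p)^-1 - 1).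
  apply/funext => q; apply: (mulfI (k0 q)).
  by have := slope_F sp sV q; rewrite mulrBr divff// mulrDr !mulr1 => <-; ring.
rewrite E in gl; have [-> ->] := has_grad_unique gl gr p.
by split; field; rewrite k0.
Qed.

Lemma grad_V2_holder : exists K alpha : R, [/\ 0 <= K, 0 < alpha &
  forall p q,
  `|V2x p - V2x q| <= K * (`|p.1 - q.1| + `|p.2 - q.2|) `^ alpha /\
  `|V2y p - V2y q| <= K * (`|p.1 - q.1| + `|p.2 - q.2|) `^ alpha].
Proof.
case: sV => _ _ [_ [alpha [K [/andP[a0 _] H]]]] _.
exists `|K|, alpha; split => // p q.
have snd_le (u : R * R) : `|u.2| <= enorm u.
  by rewrite -sqrtr_sqr ler_wsqrtr// /dot -!expr2 lerDr sqr_ge0.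
have le1 (u : R * R) : enorm u <= `|u.1| + `|u.2|.
  rewrite -[leRHS]ger0_norm ?addr_ge0// -sqrtr_sqr ler_wsqrtr// /dot -!expr2.
  rewrite sqrrD -[u.1 ^+ 2]real_normK ?num_real//.
  rewrite -[u.2 ^+ 2]real_normK ?num_real// -addrA lerD2l addrC lerDl.
  by rewrite mulrn_wge0// mulr_ge0.
have key u : enorm u = 1 ->
    `|('d V p u).2 - ('d V q u).2| <= `|K| * (`|p.1 - q.1| + `|p.2 - q.2|) `^ alpha.
  move=> u1; apply: le_trans (snd_le ('d V p u - 'd V q u)) _.
  apply: le_trans (H p q u) _; rewrite u1 mulr1.
  apply: (@le_trans _ _ (`|K| * enorm (p - q) `^ alpha)).
    by rewrite ler_wpM2r ?powR_ge0// ler_norm.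
  rewrite ler_wpM2l// ge0_ler_powR ?(ltW a0)// ?nnegrE ?addr_ge0//.
  exact: sqrtr_ge0.
by split; apply: key; rewrite /enorm /dot /= !(mulr0, mul0r, mulr1) ?addr0 ?add0r sqrtr1.
Qed.

Lemma grad_V2_unif e : 0 < e -> exists2 d : R, 0 < d &
  forall p q, `|p.1 - q.1| <= d -> `|p.2 - q.2| <= d ->
  `|V2x p - V2x q| <= e /\ `|V2y p - V2y q| <= e.
Proof.
move=> e0; have [K [alpha [K0 a0 H]]] := grad_V2_holder.
pose w := e / (K + 1).
have w0 : 0 < w by rewrite divr_gt0// ltr_wpDl.
have wa : 0 < w `^ alpha^-1 by rewrite powR_gt0.
exists (w `^ alpha^-1 / 2); first by rewrite divr_gt0.
move=> p q h1 h2.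
have hK : K * (`|p.1 - q.1| + `|p.2 - q.2|) `^ alpha <= e.
  apply: (@le_trans _ _ (K * w)).
    rewrite ler_wpM2l//.
    have -> : w = (w `^ alpha^-1) `^ alpha.
      by rewrite -powRrM mulVf ?gt_eqF// powRr1 ?ltW.
    apply: ge0_ler_powR; rewrite ?(ltW a0) ?nnegrE ?addr_ge0 ?(ltW wa)//.
    by move: h1 h2; set c := _ `^ _; lra.
  have K1 : K + 1 != 0 by rewrite gt_eqF// ltr_wpDl.
  rewrite /w mulrC -mulrA ger_pMr// mulrC ler_pdivrMr ?ltr_wpDl//; lra.
by have [x y] := H p q; split; [exact: le_trans x hK|exact: le_trans y hK].
Qed.

Lemma grad_V2_periodic : periodic2 V2x /\ periodic2 V2y.
Proof.
have key (m n : int) p : V2x (p.1 + m%:~R, p.2 + n%:~R) = V2x p /\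
                         V2y (p.1 + m%:~R, p.2 + n%:~R) = V2y p.
  have g : has_grad (fun p => (V (p.1 + m%:~R, p.2 + n%:~R)).2)
     (fun p => V2x (p.1 + m%:~R, p.2 + n%:~R))
     (fun p => V2y (p.1 + m%:~R, p.2 + n%:~R)).
    move=> X Y t x' y' dX dY.
    apply: (is_derive_eq (grad_V2 (is_derive_add dX (is_derive_const m%:~R t))
                                  (is_derive_add dY (is_derive_const n%:~R t)))).
    by rewrite !addr0.
  rewrite (_ : (fun p => _) = (fun p => (V p).2)) in g; last first.
    by apply/funext => q; rewrite (periodic2_V sV).
  exact: has_grad_unique g grad_V2 p.
by split=> p m n; have [] := key m n p.
Qed.

(** A bound of unknown size, which is all that [sup_contraction] asks for. *)
Lemma grad_V2_bounded : exists M : R, forall p, `|V2x p| <= M /\ `|V2y p| <= M.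
Proof.
have [K [alpha [K0 a0 H]]] := grad_V2_holder.
exists (Num.max `|V2x (0, 0)| `|V2y (0, 0)| + K * 2 `^ alpha) => p.
pose q := (p.1 + (- Num.floor p.1)%:~R, p.2 + (- Num.floor p.2)%:~R).
have [p1 p2] := grad_V2_periodic.
rewrite -(p1 p (- Num.floor p.1) (- Num.floor p.2)).
rewrite -(p2 p (- Num.floor p.1) (- Num.floor p.2)) -/q.
have q2 : K * (`|q.1 - 0| + `|q.2 - 0|) `^ alpha <= K * 2 `^ alpha.
  rewrite ler_wpM2l// ge0_ler_powR ?(ltW a0)// ?nnegrE ?addr_ge0// !subr0 /q /=.
  have b (x : R) : `|x + (- Num.floor x)%:~R| <= 1.
    rewrite mulrNz ger0_norm ?subr_ge0 ?floor_le_tmp// lerBlDl addrC.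
    have := floorD1_gt x; rewrite intrD => /ltW.
    by rewrite addrC.
  have := b p.1; have := b p.2; lra.
have [x y] := H q (0, 0).
have tri (a b c m : R) : `|a - b| <= c -> `|b| <= m -> `|a| <= m + c.
  by move=> h1 h2; rewrite -(subrK b a) (le_trans (ler_normD _ _))// addrC lerD.
split; [apply: tri (le_trans x q2) _|apply: tri (le_trans y q2) _];
  by rewrite le_max lexx ?orbT.
Qed.

(** The recursion of the gradient carries the factor [kap p ^+ 2], at most 4/25, which beats the
    norm of the transposed differential of F; the source is gamma phi''. *)
Lemma grad_slope_le p :
  `|slope_x p| <= 4 * (gamma * B) /\ `|slope_y p| <= 4 * (gamma * B).
Proof.
have [M HM] := grad_V2_bounded.
have V3 q : (8 / 125)^-1 >= ((V q).1 ^+ 3)^-1.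
  rewrite lef_pV2 ?posrE ?exprn_gt0 ?(V1_gt0 sV)//.
  have := V1_gt sp sV q; set h := (V q).1 => hq.
  have h2 : (2 / 5) ^+ 2 <= h ^+ 2 by nra.
  by rewrite (exprS h 2); nra.
have bd q u : `|u| <= M -> `|- u / (V q).1 ^+ 3| <= M * (8 / 125)^-1.
  move=> uM; rewrite normrM normrN normrV ?unitfE ?expf_neq0 ?gt_eqF ?(V1_gt0 sV)//.
  have h3 : 0 <= (V q).1 ^+ 3 by rewrite exprn_ge0// ltW// (V1_gt0 sV).
  by rewrite (ger0_norm h3); apply: ler_pM => //; rewrite invr_ge0.
suff : Num.max `|slope_x p| `|slope_y p| <= 2 * (2 * (gamma * B)).
  rewrite ge_max => /andP[]; rewrite (_ : 2 * (2 * (gamma * B)) = 4 * (gamma * B)); last by ring.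
  by [].
apply: (@sup_contraction _ _ (fun p => Num.max `|slope_x p| `|slope_y p|)
          (M * (8 / 125)^-1)) => {p}.
  by move=> p; have [x y] := HM p; rewrite ge_max !bd.
move=> m Hm p; have := Hm (F p); rewrite ge_max => /andP[].
have [-> ->] := grad_slope_rec p.
have k2 : kap p ^+ 2 <= 16 / 100.
  by have := kap_le sp sV p; have := kap_gt0 sp sV p; set k := kap p; nra.
have k2' : 0 <= kap p ^+ 2 by exact: sqr_ge0.
have := gphi1_bounds sp p.1; have := gphi2_le sp p.1.
move: k2 k2'; set k := kap p ^+ 2; set x := slope_x _; set y := slope_y _.
set a := gamma * phi1 _; set b := gamma * phi2 _; set e := gamma * B.
move=> k2 k2' be /andP[a1 a2] xm ym.
have e0 : 0 <= e by exact: gammaB_ge0 sp.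
clearbody x y a b k e.
have m0 : 0 <= m by exact: le_trans (normr_ge0 _) xm.
(* The entries of the differential of F are at most 2.02 and 1.02; the contraction comes from 0.16 *
   3.04 < 1/2. *)
have lin (c d : R) : 0 <= c <= 202 / 100 -> 0 <= d <= 102 / 100 ->
    `|c * x + d * y| <= 304 / 100 * m.
  move=> /andP[c0 c2] /andP[d0 d1]; apply: (le_trans (ler_normD _ _)).
  rewrite !normrM (ger0_norm c0) (ger0_norm d0).
  have := ler_pM c0 (normr_ge0 x) c2 xm; have := ler_pM d0 (normr_ge0 y) d1 ym.
  lra.
have h1 : `|(2 - a) * x + (1 - a) * y| <= 304 / 100 * m.
  by apply: lin; apply/andP; split; lra.
have h2 : `|x + y| <= 304 / 100 * m.
  by rewrite -[x]mul1r -[y]mul1r; apply: lin; apply/andP; split; lra.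
rewrite ge_max; apply/andP; split.
  apply: (le_trans (ler_normB _ _)); rewrite normrM (ger0_norm k2').
  have := ler_pM k2' (normr_ge0 _) k2 h1; lra.
rewrite normrM (ger0_norm k2').
have := ler_pM k2' (normr_ge0 _) k2 h2; lra.
Qed.

End Gradient.

(** * Differentiability of the flow *)

Section FlowDifferential.
Variable R : realType.

Lemma is_diff_eps (f : R * R -> R) (p : R * R) (c1 c2 : R) :
  (forall e : R, 0 < e -> exists2 d : R, 0 < d & forall u : R * R, `|u| < d ->
    `|f (p.1 + u.1, p.2 + u.2) - f p - (c1 * u.1 + c2 * u.2)| <= e * `|u|) ->
  is_diff p f (fun u => c1 * u.1 + c2 * u.2).
Proof.
move=> H.
pose l : R * R -> R := fun u => c1 * u.1 + c2 * u.2.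
have dl : is_diff p l l.
  exact: is_diffD (is_diffZ c1 (is_diff_fst p)) (is_diffZ c2 (is_diff_snd p)).
pose g := f - l.
have go : g \o shift p = cst (g p) + (\0 : {linear (R * R)%type -> R}) +o_ (0 : R * R) id.
  apply/eqaddoP => e e0; have [d d0 Hd] := H e e0.
  have nb := @nbhs0_lt R (R * R)%type d d0.
  apply: (filterS _ nb) => u ud; have := Hd u ud; rewrite [p.1 + _]addrC [p.2 + _]addrC.
  set lhs := (X in X <= _ -> _); set rhs := (X in _ -> X <= _).
  suff -> : lhs = rhs by [].
  congr (`| _ |); rewrite !fctE /g /= !fctE /l /cst /= -[u + p]/(u.1 + p.1, u.2 + p.2) /=.
  by ring.
have gd : differentiable g p.
  apply/diff_locallyP; have d0 : 'd g p = 0 :> (R * R -> R).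
    apply: (@diff_unique _ _ _ g (\0 : {linear (R * R)%type -> R})) => //.
    by move=> x; exact: cvg_cst.
  by split; rewrite d0 //; move=> x; exact: cvg_cst.
have d0 : 'd g p = 0 :> (R * R -> R).
  apply: (@diff_unique _ _ _ g (\0 : {linear (R * R)%type -> R})) => //.
  by move=> x; exact: cvg_cst.
have -> : f = g + l by rewrite /g subrK.
have gd' : is_diff p g (0 : R * R -> R) by split.
have := is_diffD gd' dl; rewrite add0r; exact.
Qed.

Lemma gronwall (q q' : R -> R) (c d t : R) : 0 <= t -> 0 <= c -> 0 <= d ->
  (forall s : R, 0 <= s <= t -> is_derive s 1 q (q' s)) ->
  (forall s : R, 0 <= s <= t -> q' s <= c * q s + d) ->
  q t <= expR (c * t) * (q 0 + d * t).
Proof.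
move=> t0 c0 d0 dq q'le.
have de (s : R) : is_derive s 1 (fun s => expR (- c * s)) (expR (- c * s) * (- c * 1)).
  exact: is_derive_expR (is_derive_scale (- c) (is_derive_idfun s)).
have := @derive_le_le _ (fun s => expR (- c * s) * q s)
   (fun s => expR (- c * s) * (- c * 1) * q s + expR (- c * s) * q' s)
   (fun s => d * s) (fun=> d * 1) 0 t t0.
have -> : expR (c * t) = (expR (- c * t))^-1 by rewrite mulNr expRN invrK.
rewrite ler_pdivlMl ?expR_gt0// !mulr0 expR0 mul1r subr0 => H.
suff : expR (- c * t) * q t - q 0 <= d * t by lra.
apply: H => s /[dup] sst /andP[s0 st].
  exact: is_derive_mul (de s) (dq s sst).
have e1 : expR (- c * s) <= 1.
  by rewrite expR_le1 mulNr oppr_le0 mulr_ge0.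
have e0 := expR_gt0 (- c * s).
have := ler_wpM2l (ltW e0) (q'le s sst); have := ler_wpM2r d0 e1; lra.
Qed.

Lemma sqr_normD_le (x y : R) : (`|x| + `|y|) ^+ 2 <= 2 * (x ^+ 2 + y ^+ 2).
Proof.
rewrite -[x ^+ 2]real_normK ?num_real// -[y ^+ 2]real_normK ?num_real//.
by have := sqr_ge0 (`|x| - `|y|); nra.
Qed.

Lemma norm_sqr_le (x y c : R) : 0 <= c -> x ^+ 2 + y ^+ 2 <= c ^+ 2 -> `|x| <= c.
Proof.
move=> c0 h; rewrite -(ger0_norm c0) -ler_sqr ?nnegrE// !real_normK ?num_real//.
by apply: le_trans h; rewrite lerDl sqr_ge0.
Qed.

Variables (V : R * R -> R * R) (Phi : R -> R * R -> R * R).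
Variables (a11 a12 a21 a22 : R * R -> R) (K : R).
Hypothesis gV1 : has_grad (fun p => (V p).1) a11 a12.
Hypothesis gV2 : has_grad (fun p => (V p).2) a21 a22.
Hypothesis aK : forall p,
  [/\ `|a11 p| <= K, `|a12 p| <= K, `|a21 p| <= K & `|a22 p| <= K].
Hypothesis a_unif : forall e : R, 0 < e -> exists2 d : R, 0 < d &
  forall p q, `|p.1 - q.1| <= d -> `|p.2 - q.2| <= d ->
  [/\ `|a11 p - a11 q| <= e, `|a12 p - a12 q| <= e,
      `|a21 p - a21 q| <= e & `|a22 p - a22 q| <= e].
Hypothesis flowV : flow_of V Phi.

Let K0 : 0 <= K.
Proof. by have [h _ _ _] := aK (0, 0); exact: le_trans (normr_ge0 _) h. Qed.

(** Gronwall is applied to the squared Euclidean distance, which is differentiable in time, unlike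
    the sup norm. *)
Lemma flow_dist xi zeta (t : R) : 0 <= t ->
  ((Phi t zeta).1 - (Phi t xi).1) ^+ 2 + ((Phi t zeta).2 - (Phi t xi).2) ^+ 2 <=
  expR (4 * K * t) * ((zeta.1 - xi.1) ^+ 2 + (zeta.2 - xi.2) ^+ 2).
Proof.
move=> t0; have [Phi0 dPhi] := flowV.
pose d1 s := (Phi s zeta).1 - (Phi s xi).1.
pose d2 s := (Phi s zeta).2 - (Phi s xi).2.
pose v1 s := (V (Phi s zeta)).1 - (V (Phi s xi)).1.
pose v2 s := (V (Phi s zeta)).2 - (V (Phi s xi)).2.
have dd1 (s : R) : is_derive s 1 d1 (v1 s).
  exact: is_derive_sub (is_derive_fst (dPhi s zeta)) (is_derive_fst (dPhi s xi)).
have dd2 (s : R) : is_derive s 1 d2 (v2 s).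
  exact: is_derive_sub (is_derive_snd (dPhi s zeta)) (is_derive_snd (dPhi s xi)).
have := @gronwall (fun s => d1 s * d1 s + d2 s * d2 s)
  (fun s => (v1 s * d1 s + d1 s * v1 s) + (v2 s * d2 s + d2 s * v2 s))
  (4 * K) 0 t t0.
rewrite /d1 /d2 !Phi0 mul0r addr0 -/(d1 t) -/(d2 t) !expr2; apply => //.
- by rewrite mulr_ge0.
- move=> s _; exact: is_derive_add (is_derive_mul (dd1 s) (dd1 s)) (is_derive_mul (dd2 s) (dd2 s)).
move=> s _; rewrite addr0.
have l1 : `|v1 s| <= K * (`|d1 s| + `|d2 s|).
  apply: has_grad_lip gV1 _ _ _ _ => p; by have [] := aK p.
have l2 : `|v2 s| <= K * (`|d1 s| + `|d2 s|).
  apply: has_grad_lip gV2 _ _ _ _ => p; by have [] := aK p.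
have := sqr_normD_le (d1 s) (d2 s).
have m1 : v1 s * d1 s <= `|v1 s| * `|d1 s| by rewrite -normrM ler_norm.
have m2 : v2 s * d2 s <= `|v2 s| * `|d2 s| by rewrite -normrM ler_norm.
have m3 := ler_wpM2r (normr_ge0 (d1 s)) l1.
have m4 := ler_wpM2r (normr_ge0 (d2 s)) l2.
rewrite -/(d1 s) -/(d2 s).
move: m1 m2 m3 m4 K0.
set x := d1 s; set y := d2 s; set X := `|x|; set Y := `|y|.
set a := v1 s; set b := v2 s; set A := `|a|; set C := `|b| => m1 m2 m3 m4 k0 sq.
have := ler_wpM2l k0 sq; nra.
Qed.

(** The candidate [L] solves the variational equation. By the mean value theorem and uniform
    continuity of the gradients, the error of the linear approximation obeys a linear differential
    inequality whose source is [e] times the distance of the two orbits, so Gronwall makes it O(e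
    |u|). *)
Lemma flow_is_diff xi (t : R) (L : R -> R * R -> R * R) : 0 <= t ->
  (forall u, L 0 u = u) ->
  (forall u (s : R), 0 <= s <= t ->
    is_derive s 1 (fun s => (L s u).1)
      (a11 (Phi s xi) * (L s u).1 + a12 (Phi s xi) * (L s u).2) /\
    is_derive s 1 (fun s => (L s u).2)
      (a21 (Phi s xi) * (L s u).1 + a22 (Phi s xi) * (L s u).2)) ->
  (forall u, L t u = u.1 *: L t (1, 0) + u.2 *: L t (0, 1)) ->
  is_diff xi (Phi t) (L t).
Proof.
move=> t0 L0 dL Llin; have [Phi0 dPhi] := flowV.
(* The constant returned by Gronwall: 4 K comes from the linear part, the extra 2 from splitting the
   cross term between error and source by the arithmetic-geometric inequality, and the second factor
   from [flow_dist]. *)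
pose C := expR ((4 * K + 2) * t) * (4 * expR (4 * K * t) * t).
have C0 : 0 <= C by rewrite !mulr_ge0 ?expR_ge0.
have key (e : R) : 0 < e -> exists2 d : R, 0 < d & forall u : R * R, `|u| < d ->
  ((Phi t (xi.1 + u.1, xi.2 + u.2)).1 - (Phi t xi).1 - (L t u).1) ^+ 2 +
  ((Phi t (xi.1 + u.1, xi.2 + u.2)).2 - (Phi t xi).2 - (L t u).2) ^+ 2 <=
  e ^+ 2 * C * `|u| ^+ 2.
  move=> e0; have [d d0 Hd] := a_unif e0.
  have E0 := expR_gt0 (4 * K * t).
  (* By [flow_dist], orbits starting within [D] stay within [d] up to time [t]. *)
  pose D := d / (2 * (expR (4 * K * t) + 1)).
  have D0 : 0 < D by rewrite divr_gt0// mulr_gt0// addr_gt0.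
  exists D => // u uD.
  have u12 : `|u.1| <= `|u| /\ `|u.2| <= `|u|.
    by rewrite prod_normE !le_max !lexx orbT.
  have uu : u.1 ^+ 2 + u.2 ^+ 2 <= 2 * `|u| ^+ 2.
    rewrite -[u.1 ^+ 2]real_normK ?num_real// -[u.2 ^+ 2]real_normK ?num_real//.
    by rewrite mulr_natl mulr2n; case: u12 => ? ?; apply: lerD; rewrite ler_sqr ?nnegrE.
  pose zeta := (xi.1 + u.1, xi.2 + u.2).
  pose d1 s := (Phi s zeta).1 - (Phi s xi).1.
  pose d2 s := (Phi s zeta).2 - (Phi s xi).2.
  have dist (s : R) : 0 <= s <= t ->
      d1 s ^+ 2 + d2 s ^+ 2 <= expR (4 * K * t) * (2 * `|u| ^+ 2).
    move=> /andP[s0 st]; apply: le_trans (flow_dist xi zeta s0) _.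
    rewrite /zeta /= (addrC xi.1) (addrC xi.2) !addrK.
    apply: ler_pM; rewrite ?expR_ge0 ?addr_ge0 ?sqr_ge0// ler_expR.
    by rewrite ler_wpM2l// mulr_ge0.
  have small (s : R) : 0 <= s <= t -> `|d1 s| <= d /\ `|d2 s| <= d.
    move=> sst; have h := dist s sst.
    have h' : expR (4 * K * t) * (2 * `|u| ^+ 2) <= d ^+ 2.
      have -> : d = D * (2 * (expR (4 * K * t) + 1)).
        by rewrite /D divfK// gt_eqF// mulr_gt0// addr_gt0.
      move: uD E0 D0 (normr_ge0 u); set w := `|u|; set E := expR _ => uD E0 D0 w0.
      have w2 : w ^+ 2 <= D ^+ 2 by rewrite ler_sqr ?nnegrE// ltW.
      rewrite exprMn; have : 0 <= D ^+ 2 by exact: sqr_ge0.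
      move: w2; set W := w ^+ 2; set DD := D ^+ 2; nra.
    have hd : 0 <= d by exact: ltW.
    split; first exact: norm_sqr_le hd (le_trans h h').
    by apply: norm_sqr_le hd (le_trans _ (le_trans h h')); rewrite addrC.
  pose m1 s := d1 s - (L s u).1; pose m2 s := d2 s - (L s u).2.
  pose v1 s := (V (Phi s zeta)).1 - (V (Phi s xi)).1.
  pose v2 s := (V (Phi s zeta)).2 - (V (Phi s xi)).2.
  pose w1 s := v1 s - (a11 (Phi s xi) * (L s u).1 + a12 (Phi s xi) * (L s u).2).
  pose w2 s := v2 s - (a21 (Phi s xi) * (L s u).1 + a22 (Phi s xi) * (L s u).2).
  have dm1 (s : R) : 0 <= s <= t -> is_derive s 1 m1 (w1 s).
    move=> /(dL u)[h _]; apply: is_derive_sub h.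
    exact: is_derive_sub (is_derive_fst (dPhi s zeta)) (is_derive_fst (dPhi s xi)).
  have dm2 (s : R) : 0 <= s <= t -> is_derive s 1 m2 (w2 s).
    move=> /(dL u)[_ h]; apply: is_derive_sub h.
    exact: is_derive_sub (is_derive_snd (dPhi s zeta)) (is_derive_snd (dPhi s xi)).
  have rem (f fx fy : R * R -> R) (s : R) : 0 <= s <= t -> has_grad f fx fy ->
      (forall p q, `|p.1 - q.1| <= d -> `|p.2 - q.2| <= d ->
         `|fx p - fx q| <= e /\ `|fy p - fy q| <= e) ->
      (forall p, `|fx p| <= K /\ `|fy p| <= K) ->
      `|f (Phi s zeta) - f (Phi s xi) -
         (fx (Phi s xi) * (L s u).1 + fy (Phi s xi) * (L s u).2)| <=
      e * (`|d1 s| + `|d2 s|) + K * (`|m1 s| + `|m2 s|).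
    move=> sst gf Hf fK; have [s1 s2] := small s sst.
    have [c /andP[c0 c1] ->] := has_grad_mvt gf (Phi s xi) (Phi s zeta).
    set z := (_, _); rewrite -/(d1 s) -/(d2 s).
    have zd i j : `|j| <= d -> `|i + c * j - i| <= d.
      by move=> jd; rewrite addrC addKr normrM (ger0_norm c0); have := normr_ge0 j; nra.
    have [e1 e2] := Hf z (Phi s xi) (zd _ _ s1) (zd _ _ s2).
    have [k1 k2] := fK (Phi s xi).
    rewrite (_ : _ - _ = (fx z - fx (Phi s xi)) * d1 s + (fy z - fy (Phi s xi)) * d2 s
        + (fx (Phi s xi) * m1 s + fy (Phi s xi) * m2 s)); last by rewrite /m1 /m2; ring.
    apply: (le_trans (ler_normD _ _)); rewrite [e * _]mulrDr [K * _]mulrDr; apply: lerD.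
      by apply: (le_trans (ler_normD _ _)); apply: lerD; rewrite normrM ler_wpM2r.
    by apply: (le_trans (ler_normD _ _)); apply: lerD; rewrite normrM ler_wpM2r.
  have rem1 (s : R) : 0 <= s <= t ->
      `|w1 s| <= e * (`|d1 s| + `|d2 s|) + K * (`|m1 s| + `|m2 s|).
    move=> sst; apply: (rem _ _ _ s sst gV1) => [p q h1 h2|p].
      by have [] := Hd p q h1 h2.
    by have [] := aK p.
  have rem2 (s : R) : 0 <= s <= t ->
      `|w2 s| <= e * (`|d1 s| + `|d2 s|) + K * (`|m1 s| + `|m2 s|).
    move=> sst; apply: (rem _ _ _ s sst gV2) => [p q h1 h2|p].
      by have [] := Hd p q h1 h2.
    by have [] := aK p.
  have := @gronwall (fun s => m1 s * m1 s + m2 s * m2 s)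
    (fun s => (w1 s * m1 s + m1 s * w1 s) + (w2 s * m2 s + m2 s * w2 s))
    (4 * K + 2) (2 * e ^+ 2 * (expR (4 * K * t) * (2 * `|u| ^+ 2))) t t0.
  have i1 : m1 0 = 0 by rewrite /m1 /d1 !Phi0 L0 /zeta /=; ring.
  have i2 : m2 0 = 0 by rewrite /m2 /d2 !Phi0 L0 /zeta /=; ring.
  rewrite i1 i2 !mul0r !add0r -!expr2 => H; apply: le_trans (H _ _ _ _) _.
  - by rewrite addr_ge0// mulr_ge0.
  - by rewrite mulr_ge0// ?mulr_ge0 ?sqr_ge0// ltW.
  - move=> s sst.
    exact: is_derive_add (is_derive_mul (dm1 s sst) (dm1 s sst)) (is_derive_mul (dm2 s sst) (dm2 s sst)).
  - move=> s sst; have r1 := rem1 s sst; have r2 := rem2 s sst.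
    have := dist s sst; set q0 := expR _ * _ => qd.
    have sd := sqr_normD_le (d1 s) (d2 s); have sm := sqr_normD_le (m1 s) (m2 s).
    have n1 : w1 s * m1 s <= `|w1 s| * `|m1 s| by rewrite -normrM ler_norm.
    have n2 : w2 s * m2 s <= `|w2 s| * `|m2 s| by rewrite -normrM ler_norm.
    have n3 := ler_wpM2r (normr_ge0 (m1 s)) r1.
    have n4 := ler_wpM2r (normr_ge0 (m2 s)) r2.
    move: n1 n2 n3 n4 sd sm qd; rewrite -!expr2.
    set x := m1 s; set y := m2 s; set X := `|x|; set Y := `|y|.
    set a := w1 s; set b := w2 s; set S := `|d1 s| + `|d2 s|.
    set Q := d1 s ^+ 2 + _; set A := `|a|; set B := `|b| => n1 n2 n3 n4 sd sm qd.
    have k1 := ler_wpM2l K0 sm.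
    have k2 : 2 * (e * S * (X + Y)) <= (X + Y) ^+ 2 + e ^+ 2 * S ^+ 2.
      by have := sqr_ge0 (X + Y - e * S); nra.
    have k3 : e ^+ 2 * S ^+ 2 <= e ^+ 2 * (2 * q0).
      by rewrite ler_wpM2l ?sqr_ge0//; lra.
    nra.
  - rewrite -subr_ge0 [X in 0 <= X](_ : _ = 0)//.
    by rewrite /C; ring.
have comp (f : R * R -> R) (l : R * R -> R) :
    (forall u, l u = l (1, 0) * u.1 + l (0, 1) * u.2) ->
    (forall e : R, 0 < e -> exists2 d : R, 0 < d & forall u : R * R, `|u| < d ->
      (f (xi.1 + u.1, xi.2 + u.2) - f xi - l u) ^+ 2 <= e ^+ 2 * C * `|u| ^+ 2) ->
    is_diff xi f l.
  move=> ll H; have -> : l = (fun u => l (1, 0) * u.1 + l (0, 1) * u.2) by exact/funext.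
  apply: is_diff_eps => e e0.
  have c0 : 0 < e / (C + 1) by rewrite divr_gt0// ltr_wpDl.
  have [d d0 Hd] := H _ c0; exists d => // u /Hd; rewrite -ll => h.
  apply: (@norm_sqr_le _ 0); first by rewrite mulr_ge0// ltW.
  rewrite expr0n addr0 exprMn; apply: le_trans h _; rewrite ler_wpM2r ?sqr_ge0//.
  rewrite exprMn exprVn -mulrA ger_pMr ?exprn_gt0//.
  rewrite mulrC ler_pdivrMr ?exprn_gt0 ?ltr_wpDl// mul1r; nra.
have -> : Phi t = (fun p => ((Phi t p).1, (Phi t p).2)).
  by apply/funext => p; rewrite -surjective_pairing.
have -> : L t = (fun p => ((L t p).1, (L t p).2)).
  by apply/funext => p; rewrite -surjective_pairing.
apply: is_diff_pair; apply: comp.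
- by move=> u; rewrite Llin /= -![_ *: _]/(_ * _) !(mulrC u.1) !(mulrC u.2).
- move=> e /key[d d0 Hd]; exists d => // u /Hd; apply: le_trans.
  by rewrite lerDl sqr_ge0.
- by move=> u; rewrite Llin /= -![_ *: _]/(_ * _) !(mulrC u.1) !(mulrC u.2).
- move=> e /key[d d0 Hd]; exists d => // u /Hd; apply: le_trans.
  by rewrite lerDr sqr_ge0.
Qed.

End FlowDifferential.

(** * Birkhoff sums of the contraction rate *)

Section LnBounds.
Variable R : realType.

Lemma ln_ge1V (x : R) : 0 < x -> 1 - x^-1 <= ln x.
Proof.
move=> x0; have xV : 0 < x^-1 by rewrite invr_gt0.
have : ln (1 + (x^-1 - 1)) <= x^-1 - 1.
  by apply: le_ln1Dx; rewrite ltrBrDl subrr.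
by rewrite addrC subrK lnV//; lra.
Qed.

Lemma ln_diff_le (x y : R) : 0 < x -> 0 < y -> ln x - ln y <= (x - y) / y.
Proof.
move=> x0 y0; rewrite -ln_div ?posrE//.
have : ln (1 + (x / y - 1)) <= x / y - 1.
  by apply: le_ln1Dx; rewrite ltrBrDl subrr divr_gt0.
by rewrite addrC subrK mulrBl divff ?gt_eqF.
Qed.

Lemma exists_natr_gt (x : R) : exists n : nat, x < n%:R.
Proof.
exists (Num.truncn `|x|).+1.
by rewrite (le_lt_trans (ler_norm _))// truncnS_gt.
Qed.

Lemma pow2_gt (n : nat) : n%:R <= 2 ^+ n :> R.
Proof. by rewrite -natrX ler_nat ltnW// ltn_expl. Qed.

Lemma pow2_bracket (t : R) : 1 <= t -> exists n : nat, t <= 2 ^+ n <= 2 * t.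
Proof.
move=> t1; have [m tm] := exists_natr_gt t.
have ex : exists n, t <= 2 ^+ n.
  by exists m; apply: le_trans (ltW tm) (pow2_gt m).
case: (ex_minnP ex) => -[|n] tn mn; first by exists 0; rewrite tn /= expr0; lra.
exists n.+1; rewrite tn /= exprS ler_wpM2l//.
rewrite leNgt; apply/negP => /ltW /mn; by rewrite ltnn.
Qed.

End LnBounds.

(** * The differential of the flow in the moving frame *)

Section StableFlow.
Variables (R : realType) (phi phi1 phi2 : R -> R) (gamma B : R).
Hypothesis sp : small_perturbation phi phi1 phi2 gamma B.
Variable V : R * R -> R * R.
Hypothesis sV : stable_unit_field (Fmap phi gamma) V.
Variable Phi : R -> R * R -> R * R.
Hypothesis flowV : flow_of V Phi.

Notation F := (Fmap phi gamma).
Notation slope := (slope V).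
Notation kap := (kap phi1 gamma V).
Notation kprod := (kprod phi phi1 gamma V).
Notation V2x := (V2x V).
Notation V2y := (V2y V).
Notation slope_x := (slope_x V).
Notation slope_y := (slope_y V).

Lemma V2x_le p : `|V2x p| <= 4 * (gamma * B).
Proof.
have h0 := V1_gt0 sV p; have h1 := V1_le1 sV p.
have -> : V2x p = - slope_x p * (V p).1 ^+ 3.
  by rewrite /slope_x; field; rewrite gt_eqF.
rewrite normrM normrN (ger0_norm (exprn_ge0 _ (ltW h0))).
have [sx _] := grad_slope_le sp sV p.
rewrite -[leRHS]mulr1; apply: ler_pM => //; first by rewrite exprn_ge0 ?(ltW h0).
by rewrite exprn_ile1 ?(ltW h0).
Qed.

Lemma V2y_le p : `|V2y p| <= 4 * (gamma * B).
Proof.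
have h0 := V1_gt0 sV p; have h1 := V1_le1 sV p.
have -> : V2y p = - slope_y p * (V p).1 ^+ 3.
  by rewrite /slope_y; field; rewrite gt_eqF.
rewrite normrM normrN (ger0_norm (exprn_ge0 _ (ltW h0))).
have [_ sx] := grad_slope_le sp sV p.
rewrite -[leRHS]mulr1; apply: ler_pM => //; first by rewrite exprn_ge0 ?(ltW h0).
by rewrite exprn_ile1 ?(ltW h0).
Qed.

Lemma slope_norm_le p : `|slope p| <= 2.
Proof. by have := slope_bounds sp sV p; rewrite ler_norml; lra. Qed.

Lemma slope_lip p q :
  `|slope p - slope q| <= 4 * (gamma * B) * (`|p.1 - q.1| + `|p.2 - q.2|).
Proof.
by apply: has_grad_lip (grad_slope sV) _ _ p q => z;
  have [] := grad_slope_le sp sV z.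
Qed.

Lemma d_Phi xi (t : R) :
  is_derive t 1 (fun s => (Phi s xi).1) (V (Phi t xi)).1 /\
  is_derive t 1 (fun s => (Phi s xi).2) (V (Phi t xi)).2.
Proof.
case: flowV => _ dP; split; [exact: is_derive_fst|exact: is_derive_snd].
Qed.

Lemma has_grad_flow (f fx fy : R * R -> R) xi (t : R) : has_grad f fx fy ->
  is_derive t 1 (fun s => f (Phi s xi))
    ((V (Phi t xi)).1 * (fx (Phi t xi) - slope (Phi t xi) * fy (Phi t xi))).
Proof.
move=> gf; have [d1 d2] := d_Phi xi t; have := gf _ _ _ _ _ d1 d2.
under eq_fun do rewrite -surjective_pairing.
rewrite -surjective_pairing (V2E sV) => d.
by apply: (is_derive_eq d); ring.
Qed.

Lemma unif_flow_continuous (f : R * R -> R) xi (t : R) :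
  (forall e : R, 0 < e -> exists2 d : R, 0 < d &
    forall p q, `|p.1 - q.1| <= d -> `|p.2 - q.2| <= d -> `|f p - f q| <= e) ->
  {for t, continuous (fun s => f (Phi s xi))}.
Proof.
move=> uf; have [d1 d2] := d_Phi xi t.
have c1 := is_derive_continuous d1; have c2 := is_derive_continuous d2.
apply/cvgrPdist_le => e e0; have [d d0 Hd] := uf e e0.
move/cvgrPdist_le: c1 => /(_ d d0) n1; move/cvgrPdist_le: c2 => /(_ d d0) n2.
near=> s; apply: Hd; near: s; [exact: n1|exact: n2].
Unshelve. all: by end_near. Qed.

(** In the frame (V, perp V) the variational equation is triangular, because the flow transports V
    to itself, so it is solved by two quadratures. The rate of [l] is div V, by [grad_V1]; the rate
    of [a] is [expR l] times the curvature of the flow line. *)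
Lemma flow_cocycle xi : exists a l : R -> R,
  [/\ a 0 = 0, l 0 = 0,
      forall t : R, 0 <= t -> is_derive t 1 l
        (slope (Phi t xi) * V2x (Phi t xi) + V2y (Phi t xi)),
      forall t : R, 0 <= t -> is_derive t 1 a
        (expR (l t) * (V2x (Phi t xi) - slope (Phi t xi) * V2y (Phi t xi))) &
      forall t : R, 0 < t -> is_diff xi (Phi t) (fun u =>
        tens (V (Phi t xi)) (V xi) u
        + a t *: tens (V (Phi t xi)) (perp (V xi)) u
        + expR (l t) *: tens (perp (V (Phi t xi))) (perp (V xi)) u)].
Proof.
have cx (t : R) : {for t, continuous (fun s => V2x (Phi s xi))}.
  apply: unif_flow_continuous => e /(grad_V2_unif sV)[d d0 Hd].
  by exists d => // p q h1 h2; have [] := Hd p q h1 h2.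
have cy (t : R) : {for t, continuous (fun s => V2y (Phi s xi))}.
  apply: unif_flow_continuous => e /(grad_V2_unif sV)[d d0 Hd].
  by exists d => // p q h1 h2; have [] := Hd p q h1 h2.
have cs (t : R) : {for t, continuous (fun s => slope (Phi s xi))}.
  exact: is_derive_continuous (has_grad_flow xi t (grad_slope sV)).
(* Integrating from the left of 0, with a second margin for [a], makes the derivatives at time 0
   two-sided. *)
have [l [l0 dl]] := @antiderivative R
  (fun s => slope (Phi s xi) * V2x (Phi s xi) + V2y (Phi s xi)) (-3) (-2) 0
  ltac:(lra) (fun t _ => continuousD (continuousM (cs t) (cx t)) (cy t)).
have cl (t : R) : -2 < t -> {for t, continuous (fun s => expR (l s))}.
  by move=> /dl d; exact: is_derive_continuous (is_derive_expR d).
have [a [a0 da]] := @antiderivative R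
  (fun s => expR (l s) * (V2x (Phi s xi) - slope (Phi s xi) * V2y (Phi s xi)))
  (-2) (-1) 0 ltac:(lra)
  (fun t t2 => continuousM (cl t t2) (continuousB (cx t) (continuousM (cs t) (cy t)))).
exists a, l; split => // [t t0|t t0|t t0]; [by apply: dl; lra|by apply: da; lra|].
pose L (s : R) (u : R * R) := tens (V (Phi s xi)) (V xi) u
        + a s *: tens (V (Phi s xi)) (perp (V xi)) u
        + expR (l s) *: tens (perp (V (Phi s xi))) (perp (V xi)) u.
pose al (u : R * R) := (V xi).1 * u.1 + (V xi).2 * u.2.
pose be (u : R * R) := - (V xi).2 * u.1 + (V xi).1 * u.2.
have L1 s u : (L s u).1 =
    (al u + be u * a s) * (V (Phi s xi)).1 - be u * expR (l s) * (V (Phi s xi)).2.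
  by rewrite /L /tens /= -!/(_ * _) /dot /= /al /be -![_ *: _]/(_ * _); ring.
have L2 s u : (L s u).2 =
    (al u + be u * a s) * (V (Phi s xi)).2 + be u * expR (l s) * (V (Phi s xi)).1.
  by rewrite /L /tens /= /dot /= /al /be -![_ *: _]/(_ * _); ring.
have [M HM] := grad_V2_bounded sV.
apply: (@flow_is_diff R V Phi _ _ _ _ (8 * (gamma * B)) (grad_V1 sV) (grad_V2 sV)
         _ _ flowV xi t L (ltW t0)).
- move=> p; have := V2x_le p; have := V2y_le p; have := slope_norm_le p => s2 y x.
  have g0 := gammaB_ge0 sp.
  by rewrite !(normrM (slope p)); split; [have := ler_pM (normr_ge0 _) (normr_ge0 _) s2 x
    |have := ler_pM (normr_ge0 _) (normr_ge0 _) s2 y| |]; lra.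
- move=> e e0; have [d d0 Hd] := grad_V2_unif sV (divr_gt0 e0 (ltr0n R 4)).
  have gB := gammaB_le sp; have gB0 := gammaB_ge0 sp.
  have prod (f : R * R -> R) p q : (forall z, `|f z| <= 4 * (gamma * B)) ->
      `|f p - f q| <= e / 4 -> `|p.1 - q.1| <= e / 4 -> `|p.2 - q.2| <= e / 4 ->
      `|slope p * f p - slope q * f q| <= e.
    move=> fb df h1 h2.
    rewrite (_ : _ - _ = slope p * (f p - f q) + (slope p - slope q) * f q); last by ring.
    apply: (le_trans (ler_normD _ _)).
    rewrite (normrM (slope p)) (normrM (_ - _)).
    have := ler_pM (normr_ge0 _) (normr_ge0 _) (slope_norm_le p) df.
    have s1 : `|slope p - slope q| <= e / 2.
      apply: le_trans (slope_lip p q) _.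
      have := normr_ge0 (p.1 - q.1); have := normr_ge0 (p.2 - q.2).
      by move: h1 h2; set x := `|_|; set y := `|_|; nra.
    have f1 : `|f q| <= 1 by have := fb q; lra.
    have := ler_pM (normr_ge0 _) (normr_ge0 _) s1 f1; lra.
  exists (Num.min d (e / 4)); first by rewrite lt_min d0 divr_gt0.
  move=> p q; rewrite !le_min => /andP[p1 p2] /andP[q1 q2].
  have [hx hy] := Hd p q p1 q1.
  by split; [apply: prod V2x_le hx p2 q2|apply: prod V2y_le hy p2 q2| |]; lra.
- case: flowV => P0 _ u.
  have := V_unit sV xi; rewrite (surjective_pairing (L 0 u)) L1 L2 P0 a0 l0 expR0.
  rewrite !mulr0 !addr0 !mulr1 /al /be => h; rewrite [RHS]surjective_pairing.
  congr (_, _).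
    by rewrite -[RHS]mul1r -h; ring.
  by rewrite -[RHS]mul1r -h; ring.
- move=> u s /andP[s0 _].
  have dls : is_derive s 1 l (slope (Phi s xi) * V2x (Phi s xi) + V2y (Phi s xi)).
    by apply: dl; lra.
  have das : is_derive s 1 a
      (expR (l s) * (V2x (Phi s xi) - slope (Phi s xi) * V2y (Phi s xi))).
    by apply: da; lra.
  have dV1 := has_grad_flow xi s (grad_V1 sV).
  have dV2 := has_grad_flow xi s (grad_V2 sV).
  have dab := is_derive_add (is_derive_const (al u) s) (is_derive_scale (be u) das).
  have dbe := is_derive_scale (be u) (is_derive_expR dls).
  split.
    under eq_fun do rewrite L1.
    apply: (is_derive_eq (is_derive_sub (is_derive_mul dab dV1) (is_derive_mul dbe dV2))).
    by rewrite L1 L2 (V2E sV); ring.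
  under eq_fun do rewrite L2.
  apply: (is_derive_eq (is_derive_add (is_derive_mul dab dV2) (is_derive_mul dbe dV1))).
  by rewrite L1 L2 (V2E sV); ring.
- move=> u; rewrite [LHS]surjective_pairing.
  rewrite -[RHS]/(u.1 * (L t (1, 0)).1 + u.2 * (L t (0, 1)).1,
                  u.1 * (L t (1, 0)).2 + u.2 * (L t (0, 1)).2).
  by rewrite !L1 !L2 /al /be /=; congr (_, _); ring.
Qed.

End StableFlow.

(** * The divergence as a difference of Birkhoff sums *)

Section Birkhoff.
Variables (R : realType) (phi phi1 phi2 : R -> R) (gamma B : R).
Hypothesis sp : small_perturbation phi phi1 phi2 gamma B.
Variable V : R * R -> R * R.
Hypothesis sV : stable_unit_field (Fmap phi gamma) V.

Notation F := (Fmap phi gamma).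
Notation slope := (slope V).
Notation kap := (kap phi1 gamma V).
Notation kprod := (kprod phi phi1 gamma V).
Notation slope_x := (slope_x V).
Notation slope_y := (slope_y V).

Definition birkhoff n p := \sum_(k < n) ln (kap (iter k F p)).

Lemma birkhoffSr n p : birkhoff n.+1 p = birkhoff n p + ln (kap (iter n F p)).
Proof. exact: big_ord_recr. Qed.

Lemma birkhoff0 p : birkhoff 0 p = 0.
Proof. exact: big_ord0. Qed.

Lemma birkhoffD m n p : birkhoff (m + n) p = birkhoff m p + birkhoff n (iter m F p).
Proof.
elim: n => [|n ih]; first by rewrite addn0 birkhoff0 addr0.
by rewrite addnS !birkhoffSr ih addrA -iterD addnC.
Qed.

Lemma periodic2_birkhoff n : periodic2 (birkhoff n).
Proof.
move=> p i j; apply: eq_bigr => k _; congr ln.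
exact: (periodic2_iter_F sp k (periodic2_kap sp sV)).
Qed.

Lemma kprod0 p : kprod 0 p = 1. Proof. exact: big_ord0. Qed.

Lemma kprod_bounds n p : 4^-1 ^+ n <= kprod n p <= 2^-1 ^+ n.
Proof.
elim: n => [|n /andP[h1 h2]]; first by rewrite kprod0 !expr0 lexx.
rewrite (kprodSr _ _ _ _ n) !exprSr; set q := iter n F p.
have k1 := ltW (kap_ge sp sV q); have k2 := ltW (kap_lt_half sp sV q).
have e0 : 0 <= 4^-1 ^+ n :> R by rewrite exprn_ge0.
have k0 := ltW (kap_gt0 sp sV q).
by rewrite !ler_pM//; exact: le_trans e0 h1.
Qed.

Lemma kprod_gt0 n p : 0 < kprod n p.
Proof.
by have /andP[h _] := kprod_bounds n p; apply: lt_le_trans h; rewrite exprn_gt0.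
Qed.

Lemma ln_kprod n p : ln (kprod n p) = birkhoff n p.
Proof.
elim: n => [|n ih]; first by rewrite kprod0 ln1 birkhoff0.
by rewrite (kprodSr _ _ _ _ n) birkhoffSr lnM ?posrE ?kprod_gt0 ?(kap_gt0 sp sV)// ih.
Qed.

Lemma ln_kap_diff p q : ln (kap p) - ln (kap q) <= 4 * (gamma * B).
Proof.
apply: le_trans (ln_diff_le (kap_gt0 sp sV p) (kap_gt0 sp sV q)) _.
have kq := kap_ge sp sV q; have gB := gammaB_ge0 sp.
have := kap_lam sp sV p; have := kap_lam sp sV q; rewrite !ler_norml.
move=> /andP[q1 q2] /andP[p1 p2].
by rewrite ler_pdivrMr ?(kap_gt0 sp sV)//; nra.
Qed.

Lemma birkhoff_diff n p q :
  birkhoff n p - birkhoff n q <= n%:R * (4 * (gamma * B)).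
Proof.
elim: n => [|n ih]; first by rewrite !birkhoff0 subrr mul0r.
rewrite !birkhoffSr -natr1 mulrDl mul1r.
have := ln_kap_diff (iter n F p) (iter n F q); lra.
Qed.

(* Invariance of the direction (1, - slope) under F, differentiated:
   - slope_y is the divergence of the field (1, - slope). *)
Lemma dln_kap_along p :
  (- (gamma * phi2 p.1) - slope_x p - slope p * - slope_y p) / kap p =
  kap p * slope_y (F p) - slope_y p.
Proof.
have [ex ey] := grad_slope_rec sp sV p; have k0 := kap_neq0 sp sV p.
apply: (mulIf k0); rewrite divfK// {1}ex ey.
have -> : slope p = 2 - gamma * phi1 p.1 - kap p by rewrite /kap; ring.
ring.
Qed.

Variable Phi : R -> R * R -> R * R.
Hypothesis flowV : flow_of V Phi.

Notation curve n xi s := (iter n F (Phi s xi)).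

Definition speed n xi (s : R) := kprod n (Phi s xi) * (V (Phi s xi)).1.

Lemma speed_bounds n xi s :
  2 / 5 * 4^-1 ^+ n <= speed n xi s <= 2^-1 ^+ n.
Proof.
rewrite /speed; have /andP[k1 k2] := kprod_bounds n (Phi s xi).
have h1 := ltW (V1_gt sp sV (Phi s xi)); have h2 := V1_le1 sV (Phi s xi).
have e0 : 0 <= 4^-1 ^+ n :> R by rewrite exprn_ge0.
have h0 := ltW (V1_gt0 sV (Phi s xi)).
apply/andP; split; first by rewrite mulrC ler_pM.
by rewrite -[leRHS]mulr1 ler_pM//; exact: le_trans e0 k1.
Qed.

Lemma speed_gt0 n xi s : 0 < speed n xi s.
Proof. by rewrite mulr_gt0 ?kprod_gt0 ?(V1_gt0 sV). Qed.

Lemma d_curve n xi (t : R) :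
  is_derive t 1 (fun s => (curve n xi s).1) (speed n xi t) /\
  is_derive t 1 (fun s => (curve n xi s).2)
    (- slope (curve n xi t) * speed n xi t).
Proof.
elim: n => [|n [d1 d2]].
  have [d1 d2] := d_Phi flowV xi t; rewrite /speed kprod0 mul1r.
  by split=> //; rewrite -(V2E sV).
have [] := curve_F sp d1 d2; rewrite -surjective_pairing => e1 e2.
have E s : (F ((curve n xi s).1, (curve n xi s).2)) = curve n.+1 xi s.
  by rewrite -surjective_pairing.
have sE : speed n.+1 xi t = kap (curve n xi t) * speed n xi t.
  by rewrite /speed (kprodSr _ _ _ _ n); ring.
split.
  under eq_fun do rewrite -E.
  by apply: (is_derive_eq e1); rewrite sE /dF /kap /=; ring.
under eq_fun do rewrite -E.
apply: (is_derive_eq e2); rewrite sE /dF /=; set q := iter n F _.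
rewrite [RHS](_ : _ = (kap q - kap q * (1 + slope (F q))) * speed n xi t); last by ring.
by rewrite (slope_F sp sV) /kap; ring.
Qed.

Lemma has_grad_curve (f fx fy : R * R -> R) n xi (t : R) : has_grad f fx fy ->
  is_derive t 1 (fun s => f (curve n xi s))
    (speed n xi t * (fx (curve n xi t) - slope (curve n xi t) * fy (curve n xi t))).
Proof.
move=> gf; have [d1 d2] := d_curve n xi t; have := gf _ _ _ _ _ d1 d2.
under eq_fun do rewrite -surjective_pairing.
by rewrite -surjective_pairing => d; apply: (is_derive_eq d); ring.
Qed.

(* The derivative telescopes by [dln_kap_along]. *)
Lemma d_birkhoff n xi (t : R) :
  is_derive t 1 (fun s => birkhoff n (Phi s xi))
    (speed n xi t * slope_y (curve n xi t) - speed 0 xi t * slope_y (Phi t xi)).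
Proof.
elim: n => [|n ih].
  under eq_fun do rewrite birkhoff0.
  by rewrite subrr; exact: is_derive_const.
under eq_fun do rewrite birkhoffSr.
have dk := has_grad_curve n xi t (grad_kap sp sV).
have dl := is_derive_ln (f := fun s => kap (curve n xi s)) (kap_gt0 sp sV _) dk.
apply: (is_derive_eq (is_derive_add ih dl)).
rewrite -[in X in _ + X]mulrA dln_kap_along /speed (kprodSr _ _ _ _ n); ring.
Qed.

Lemma d_ln_V1 xi (t : R) :
  is_derive t 1 (fun s => ln (V (Phi s xi)).1)
    (slope (Phi t xi) * V2x V (Phi t xi) - slope (Phi t xi) ^+ 2 * V2y V (Phi t xi)).
Proof.
have h0 := V1_gt0 sV (Phi t xi).
apply: (is_derive_eq (is_derive_ln (f := fun s => (V (Phi s xi)).1) h0 (has_grad_flow sV flowV xi t (grad_V1 sV)))).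
by field; rewrite gt_eqF.
Qed.

(** Since V is V1 times (1, - slope), its divergence is the time derivative of ln V1 minus V1
    [slope_y]. The latter telescopes against the Birkhoff sum, leaving only the term at level n,
    which is weighted by the speed of the image curve and so integrates to at most a multiple of its
    horizontal extent. *)
Lemma cocycle_birkhoff xi (l : R -> R) n (t : R) : 0 <= t -> l 0 = 0 ->
  (forall t : R, 0 <= t -> is_derive t 1 l
     (slope (Phi t xi) * V2x V (Phi t xi) + V2y V (Phi t xi))) ->
  `|l t - (ln (V (Phi t xi)).1 - ln (V xi).1)
        - (birkhoff n (Phi t xi) - birkhoff n xi)| <=
  4 * (gamma * B) * ((curve n xi t).1 - (iter n F xi).1).
Proof.
move=> t0 l0 dl.
have P0 : Phi 0 xi = xi by case: flowV.
pose f s := l s - ln (V (Phi s xi)).1 - birkhoff n (Phi s xi).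
pose f' s := - (speed n xi s * slope_y (curve n xi s)).
pose c s := 4 * (gamma * B) * (curve n xi s).1.
have df (s : R) : 0 <= s <= t -> is_derive s 1 f (f' s).
  move=> /andP[s0 _].
  apply: (is_derive_eq (is_derive_sub (is_derive_sub (dl s s0) (d_ln_V1 xi s)) (d_birkhoff n xi s))).
  have -> : speed 0 xi s = (V (Phi s xi)).1 by rewrite /speed kprod0 mul1r.
  have -> : (V (Phi s xi)).1 * slope_y (Phi s xi) =
      - V2y V (Phi s xi) * (1 + slope (Phi s xi) ^+ 2).
    have h0 : (V (Phi s xi)).1 != 0 by rewrite gt_eqF ?(V1_gt0 sV).
    apply: (mulfI (expf_neq0 2 h0)).
    rewrite [in RHS]mulrCA (V_slope sV) /slope_y; field.
    exact: h0.
  by rewrite /f'; ring.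
have dc (s : R) : is_derive s 1 c (4 * (gamma * B) * speed n xi s).
  by apply: is_derive_scale; have [] := d_curve n xi s.
have bd (s : R) : `|speed n xi s * slope_y (curve n xi s)| <= 4 * (gamma * B) * speed n xi s.
  rewrite normrM (ger0_norm (ltW (speed_gt0 _ _ _))) mulrC ler_wpM2r ?(ltW (speed_gt0 _ _ _))//.
  by have [] := grad_slope_le sp sV (curve n xi s).
have up : f t - f 0 <= c t - c 0.
  apply: derive_le_le t0 df (fun s _ => dc s) _ => s _.
  by have := bd s; rewrite ler_norml /f'; lra.
have dn : (- c t) - (- c 0) <= f t - f 0.
  apply: derive_le_le t0 (fun s _ => is_derive_opp (dc s)) df _ => s _.
  by have := bd s; rewrite ler_norml /f'; lra.
move: up dn; rewrite /f /c P0 l0 ler_norml => up dn.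
by apply/andP; split; lra.
Qed.

Lemma ln_V1_diff p q : `|ln (V p).1 - ln (V q).1| <= 3 / 2.
Proof.
have key x y : ln (V x).1 - ln (V y).1 <= 3 / 2.
  apply: le_trans (ln_diff_le (V1_gt0 sV x) (V1_gt0 sV y)) _.
  rewrite ler_pdivrMr ?(V1_gt0 sV)//.
  by have := V1_gt sp sV y; have := V1_le1 sV x; lra.
by rewrite ler_norml; have := key p q; have := key q p; lra.
Qed.

Lemma curve_disp n xi (t : R) : 0 <= t ->
  2 / 5 * 4^-1 ^+ n * t <= (curve n xi t).1 - (iter n F xi).1 <= 2^-1 ^+ n * t.
Proof.
move=> t0; have P0 : Phi 0 xi = xi by case: flowV.
have d1 (s : R) : is_derive s 1 (fun s => (curve n xi s).1) (speed n xi s).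
  by have [] := d_curve n xi s.
have dlin (k s : R) : is_derive s 1 (fun s => k * s) (k * 1).
  exact: (is_derive_scale k (is_derive_idfun s)).
apply/andP; split.
  have := derive_le_le t0 (fun s _ => dlin (2 / 5 * 4^-1 ^+ n) s) (fun s _ => d1 s).
  rewrite mulr0 subr0 P0; apply => s _; rewrite mulr1.
  by have /andP[] := speed_bounds n xi s.
have := derive_le_le t0 (fun s _ => d1 s) (fun s _ => dlin (2^-1 ^+ n) s).
rewrite mulr0 subr0 P0; apply => s _; rewrite mulr1.
by have /andP[] := speed_bounds n xi s.
Qed.

(** With 2^n between t and 2t, F^n shrinks the whole flow segment to extent at most 1. The Birkhoff
    sums differ by at most 4 gamma B per step, and n <= 1 + 2 ln t because ln 2 >= 1/2. The bound is
    uniform over s <= t so that it can be integrated to estimate [a]. *)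
Lemma cocycle_le xi (l : R -> R) (s t : R) : 0 <= s <= t -> 1 <= t -> l 0 = 0 ->
  (forall t : R, 0 <= t -> is_derive t 1 l
     (slope (Phi t xi) * V2x V (Phi t xi) + V2y V (Phi t xi))) ->
  `|l s| <= 2 + 8 * (gamma * B) * ln t.
Proof.
move=> /andP[s0 st] t1 l0 dl.
have [n /andP[tn nt]] := pow2_bracket t1.
have gB0 := gammaB_ge0 sp; have gB := gammaB_le sp.
have := cocycle_birkhoff n s0 l0 dl; have := ln_V1_diff (Phi s xi) xi.
have /andP[_ ] := curve_disp n xi s0.
have : 2^-1 ^+ n * s <= 1.
  by rewrite exprVn ler_pdivrMl ?exprn_gt0// mulr1; exact: le_trans tn.
have := birkhoff_diff n (Phi s xi) xi; have := birkhoff_diff n xi (Phi s xi).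
have ln2 : 2^-1 <= ln 2 :> R by have := @ln_ge1V R 2 (ltr0n R 2); lra.
have lnt := ln_ge0 t1.
have : n%:R <= 1 + 2 * ln t.
  have t0 : 0 < t by lra.
  have t20 : 0 < 2 * t by lra.
  have : ln (2 ^+ n) <= ln (2 * t) by rewrite ler_ln ?posrE ?exprn_gt0.
  rewrite lnXn// lnM ?posrE//.
  rewrite -[ln 2 *+ n]mulr_natl; have : 0 <= n%:R :> R by [].
  set N := n%:R; set L := ln 2 in ln2 *; set T := ln t in lnt * => N0 h.
  rewrite leNgt; apply/negP => hN.
  have : 0 <= (N - 1) * (L - 2^-1) by apply: mulr_ge0; lra.
  nra.
set N := n%:R; set T := ln t in lnt *; set g := gamma * B in gB0 gB *.
set u := birkhoff n _; set v := birkhoff n xi; set x := 2^-1 ^+ n * s.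
set D := _ - (iter n F xi).1; set w := ln _ - ln _ => h1 h2 h3 h4 h5 h6.
rewrite !ler_norml => /andP[a1 a2]; have /andP[b1 b2] : - (3/2) <= w <= 3 / 2 by rewrite -ler_norml.
have k1 : g * N <= g * (1 + 2 * T) by rewrite ler_wpM2l.
have k2 : g * D <= g by nra.
by apply/andP; split; lra.
Qed.

End Birkhoff.

(** * Polynomial bounds on the differential of the flow *)

Section PartOne.
Variable R : realType.

Lemma flow_differential_bounds (phi phi1 phi2 : R -> R) (gamma B : R) V Phi :
  small_perturbation phi phi1 phi2 gamma B ->
  stable_unit_field (Fmap phi gamma) V -> flow_of V Phi ->
  exists a b : R * R -> R -> R, flow_differential V Phi a b /\
    forall xi (t : R), 1 <= t ->
      [/\ expR (- 2) * t `^ (- (8 * (gamma * B))) <= b xi t,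
          b xi t <= expR 2 * t `^ (8 * (gamma * B)) &
          `|a xi t| <= 12 * (gamma * B) * (expR 2 * t `^ (8 * (gamma * B))) * t].
Proof.
move=> sp sV flowV.
have [al Hal] := choice (fun xi => flow_cocycle sp sV flowV xi).
have [l H] := choice Hal.
exists al, (fun xi t => expR (l xi t)); split.
  by move=> t xi t0; have [_ _ _ _] := H xi; exact.
move=> xi t t1; have t0 : 0 < t by exact: lt_le_trans t1.
have [a0 l0 dl da _] := H xi.
have bl (s : R) : 0 <= s <= t -> `|l xi s| <= 2 + 8 * (gamma * B) * ln t.
  by move=> st; exact: (cocycle_le sp sV flowV st t1 l0 dl).
have pE x : t `^ x = expR (x * ln t) by rewrite /powR gt_eqF.
have tt : 0 <= t <= t by rewrite lexx (ltW t0).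
rewrite !pE -!expRD.
have gB0 := gammaB_ge0 sp.
have /andP[b1 b2] : - (2 + 8 * (gamma * B) * ln t) <= l xi t <= 2 + 8 * (gamma * B) * ln t.
  by rewrite -ler_norml bl.
split; [by rewrite ler_expR; lra|by rewrite ler_expR; lra|].
(* 12 = 4 + 2 * 4, from [V2x_le], [V2y_le] and |slope| <= 2. *)
set K := 12 * _ * _.
pose a' s := expR (l xi s) * (V2x V (Phi s xi) - slope V (Phi s xi) * V2y V (Phi s xi)).
have a'K (s : R) : 0 <= s <= t -> `|a' s| <= K.
  move=> st; rewrite /a' /K (normrM (expR _)) ger0_norm ?expR_ge0// mulrC.
  apply: ler_pM => //; rewrite ?expR_ge0//; last first.
    by rewrite ler_expR; have := bl s st; rewrite ler_norml => /andP[].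
  apply: (le_trans (ler_normB _ _)); rewrite (normrM (slope _ _)).
  have := ler_pM (normr_ge0 _) (normr_ge0 _) (slope_norm_le sp sV (Phi s xi))
     (V2y_le sp sV (Phi s xi)).
  have := V2x_le sp sV (Phi s xi); lra.
have da' (s : R) : 0 <= s <= t -> is_derive s 1 (al xi) (a' s).
  by move=> /andP[s0 _]; exact: da.
have [c ct] := is_derive_mvt (ltW t0) da'.
rewrite a0 !subr0 => ->; rewrite normrM (ger0_norm (ltW t0)) ler_wpM2r ?(ltW t0)//.
exact: a'K.
Qed.

Lemma periodic_bounded (f : R -> R) : (forall x, f (x + 1) = f x) ->
  (forall x, {for x, continuous f}) -> exists M : R, forall x, `|f x| <= M.
Proof.
move=> pf cf.
have [M HM] : exists M : R, forall x, 0 <= x <= 1 -> `|f x| <= M.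
  have : compact (f @` `[0, 1]).
    apply: continuous_compact; last exact: segment_compact.
    by apply: continuous_subspaceT => x; exact: cf.
  move=> /compact_bounded[M [Mr HM]]; exists (M + 1) => x x01.
  by apply: HM; [rewrite ltrDl|exists x].
exists M => x; rewrite -(periodic_int pf x (- Num.floor x)).
apply: HM; rewrite mulrNz subr_ge0 floor_le_tmp lerBlDl.
by have := floorD1_gt x; rewrite intrD => /ltW; rewrite addrC.
Qed.

Lemma small_perturbation_exists (phi : R -> R) : smooth_zero_mean phi ->
  exists2 B : R, 0 <= B & forall gamma : R, 0 <= gamma -> gamma * B <= 50^-1 ->
    small_perturbation phi (derive1n 1 phi) (derive1n 2 phi) gamma B.
Proof.
case=> pf df _.
have dn n (x : R) : is_derive x 1 (derive1n n phi) (derive1n n.+1 phi x).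
  by split; [exact: df|rewrite derive1nS derive1E].
have pn n x : derive1n n phi (x + 1) = derive1n n phi x.
  elim: n x => [//|n ih] x.
  have := @is_derive_compose _ (derive1n n phi) (fun y => y + 1) x _ _ (dn n (x + 1))
    (is_derive_add (is_derive_idfun x) (is_derive_const 1 x)).
  rewrite (_ : (fun y => derive1n n phi (y + 1)) = derive1n n phi).
    by case=> _; rewrite addr0 mulr1 => <-; have [_ <-] := dn n x.
  exact/funext.
have cn n x : {for x, continuous (derive1n n phi)} := is_derive_continuous (dn n x).
have [M1 H1] := periodic_bounded (pn 1) (cn 1).
have [M2 H2] := periodic_bounded (pn 2) (cn 2).
exists (Num.max M1 M2).
  by rewrite le_max (le_trans (normr_ge0 _) (H1 0)).
move=> gamma g0 gB; split => // [x|x|x].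
- exact: (dn 0).
- by rewrite le_max H1.
- by rewrite le_max H2 orbT.
Qed.

Lemma smooth_flow_bounds (phi : R -> R) : smooth_zero_mean phi ->
    exists gamma0 C0 bstar tstar : R,
      [/\ 0 < gamma0, 0 < C0, 0 < bstar & 0 < tstar] /\
      forall (gamma : R) (V : R * R -> R * R) (Phi : R -> R * R -> R * R),
        0 <= gamma < gamma0 ->
        stable_unit_field (Fmap phi gamma) V ->
        flow_of V Phi ->
        exists a b : R * R -> R -> R,
          flow_differential V Phi a b /\
          forall (xi : R * R) (t : R), tstar <= t ->
            [/\ C0 * t `^ (- (bstar * gamma)) <= b xi t,
                b xi t <= C0^-1 * t `^ (bstar * gamma) &
                `|a xi t| <= gamma * C0^-1 * t `^ (1 + bstar * gamma)].
Proof.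
move=> /small_perturbation_exists[B B0 spB].
(* The added units keep the constants positive when [B] is 0. One C0 has to serve both the factor
   exp 2 in the bounds on b and the factor 12 B exp 2 in that on a. *)
exists (50 * (B + 1))^-1, (expR 2 * (1 + 12 * B))^-1, (8 * B + 1), 1.
have E2 := expR_gt0 (2 : R).
split; first by split; rewrite ?invr_gt0 ?mulr_gt0//; lra.
move=> gamma V Phi /andP[g0 g1] sV flowV.
have gB : gamma * B <= 50^-1.
  have : gamma * (B + 1) <= 50^-1.
    by rewrite -ler_pdivlMr -?invfM ?ltW//; lra.
  lra.
have [a [b [dab H]]] := flow_differential_bounds (spB gamma g0 gB) sV flowV.
exists a, b; split=> // xi t t1.
have t0 : 0 < t by exact: lt_le_trans t1.
have [h1 h2 h3] := H xi t t1.
have gB0 : 0 <= gamma * B by rewrite mulr_ge0.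
have p0 := powR_gt0 (8 * (gamma * B)) t0.
have pm : t `^ (8 * (gamma * B)) <= t `^ ((8 * B + 1) * gamma).
  by rewrite ler_powR//; lra.
have pm' : t `^ (- ((8 * B + 1) * gamma)) <= t `^ (- (8 * (gamma * B))).
  by rewrite ler_powR//; lra.
rewrite invrK; split.
- have E1 : 0 < expR 2 * (1 + 12 * B) by rewrite mulr_gt0//; lra.
  apply: le_trans h1; apply: (ler_pM _ _ _ pm'); rewrite ?powR_ge0 ?invr_ge0 ?(ltW E1)//.
  by rewrite expRN lef_pV2 ?posrE// ler_peMr ?(ltW E2)//; lra.
- apply: (le_trans h2); apply: (ler_pM _ _ _ pm); rewrite ?powR_ge0 ?(ltW E2)//.
  by rewrite ler_peMr ?(ltW E2)//; lra.
apply: (le_trans h3).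
rewrite powRD ?powRr1 ?(ltW t0) ?(gt_eqF t0) ?implybT//.
move: pm p0; set p := _ `^ _; set q := _ `^ _; set E := expR 2 in E2 * => pq p0.
rewrite [leLHS](_ : _ = (12 * B) * (t * gamma * E * p)); last by ring.
rewrite [leRHS](_ : _ = (1 + 12 * B) * (t * gamma * E * q)); last by ring.
apply: ler_pM; rewrite ?mulr_ge0 ?(ltW t0) ?(ltW E2) ?(ltW p0)//; first by lra.
by rewrite ler_wpM2l// !mulr_ge0 ?(ltW t0) ?(ltW E2).
Qed.

End PartOne.

(** * Grid averages *)

Section GridSums.
Variable R : realType.
Implicit Types (f g : R * R -> R) (u : R -> R).

Definition lip (K : R) f :=
  forall p q, `|f p - f q| <= K * (`|p.1 - q.1| + `|p.2 - q.2|).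

Lemma lip_sqr K f : lip K f -> (forall p, `|f p| <= 1) ->
  lip (2 * K) (fun p => f p ^+ 2).
Proof.
move=> fK f1 p q; rewrite subr_sqr normrM mulrC -mulrA.
apply: ler_pM => //; have := ler_normD (f p) (f q).
by have := f1 p; have := f1 q; lra.
Qed.

Definition grid_sum N f : R :=
  \sum_(i < N) \sum_(j < N) f (i%:R / N%:R, j%:R / N%:R).

(* Comparison of the averages over the N x N grid up to an error O(1/N). *)
Definition grid_le f g :=
  exists C : R, forall N, (0 < N)%N -> grid_sum N f <= grid_sum N g + C * N%:R.

Lemma grid_sumD N f g : grid_sum N (fun p => f p + g p) = grid_sum N f + grid_sum N g.
Proof.
by rewrite /grid_sum -big_split; apply: eq_bigr => i _; rewrite -big_split.
Qed.

Lemma grid_sumZ N (c : R) f : grid_sum N (fun p => c * f p) = c * grid_sum N f.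
Proof.
by rewrite /grid_sum mulr_sumr; apply: eq_bigr => i _; rewrite mulr_sumr.
Qed.

Lemma grid_sum_cst N (c : R) : grid_sum N (fun=> c) = c * N%:R ^+ 2.
Proof.
rewrite /grid_sum !sumr_const !card_ord -[c *+ N]mulr_natr -[_ *+ N]mulr_natr.
by rewrite -mulrA.
Qed.

Lemma grid_sum_le N f g : (forall p, f p <= g p) -> grid_sum N f <= grid_sum N g.
Proof. by move=> fg; apply: ler_sum => i _; apply: ler_sum => j _. Qed.

Lemma grid_le_le f g : (forall p, f p <= g p) -> grid_le f g.
Proof. by move=> fg; exists 0 => N _; rewrite mul0r addr0 grid_sum_le. Qed.

Lemma grid_le_trans g f h : grid_le f g -> grid_le g h -> grid_le f h.
Proof.
move=> [C1 H1] [C2 H2]; exists (C1 + C2) => N N0.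
by have := H1 N N0; have := H2 N N0; rewrite mulrDl; lra.
Qed.

Lemma grid_leD f1 g1 f2 g2 : grid_le f1 g1 -> grid_le f2 g2 ->
  grid_le (fun p => f1 p + f2 p) (fun p => g1 p + g2 p).
Proof.
move=> [C1 H1] [C2 H2]; exists (C1 + C2) => N N0; rewrite !grid_sumD.
by have := H1 N N0; have := H2 N N0; rewrite mulrDl; lra.
Qed.

Lemma grid_leZ (c : R) f g : 0 <= c -> grid_le f g ->
  grid_le (fun p => c * f p) (fun p => c * g p).
Proof.
move=> c0 [C H]; exists (c * C) => N N0; rewrite !grid_sumZ.
by have := ler_wpM2l c0 (H N N0); rewrite mulrDr mulrA.
Qed.

Lemma grid_le_refl f : grid_le f f. Proof. exact: grid_le_le. Qed.

(** Otherwise (a - b) N^2 would be at most C N for every N. *)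
Lemma grid_le_cst_ex (a b : R) f : grid_le (fun=> a) f -> b < a -> exists p, b < f p.
Proof.
move=> [C H] ba; apply: contrapT => no.
have fb p : f p <= b by rewrite leNgt; apply/negP => h; apply: no; exists p.
have [n hn] := exists_natr_gt (C / (a - b)).
have n1 : C / (a - b) < n.+1%:R by apply: lt_le_trans hn _; rewrite ler_nat.
have := H n.+1 isT; have := grid_sum_le n.+1 fb; rewrite !grid_sum_cst.
move: n1; rewrite ltr_pdivrMr ?subr_gt0//.
have : 0 < n.+1%:R :> R by rewrite ltr0n.
set M := n.+1%:R; set G := grid_sum _ f => M0 hC h1 h2.
have := ltr_pM2l M0 C (M * (a - b)); rewrite hC => /esym; lra.
Qed.

Lemma periodic_sum_nat u N (c : R) (m : nat) : (0 < N)%N ->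
  (forall x, u (x + 1) = u x) ->
  \sum_(j < N) u (c + (j%:R + m%:R) / N%:R) = \sum_(j < N) u (c + j%:R / N%:R).
Proof.
move=> N0 pu; elim: m => [|m ih].
  by apply: eq_bigr => j _; rewrite addr0.
rewrite -{}ih; case: N N0 => // N _.
pose w (j : nat) := u (c + (j%:R + m%:R) / N.+1%:R).
transitivity (\sum_(j < N.+1) w j.+1).
  by apply: eq_bigr => j _; rewrite /w -!natr1; congr (u (_ + _ / _)); ring.
rewrite big_ord_recr [RHS]big_ord_recl /= addrC; congr (_ + _).
rewrite /w -[RHS]pu; congr u; rewrite mulr0n add0r.
have NN : N.+1%:R != 0 :> R by rewrite pnatr_eq0.
by field.
Qed.

Lemma periodic_sum_int u N (c : R) (m : int) : (0 < N)%N ->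
  (forall x, u (x + 1) = u x) ->
  \sum_(j < N) u (c + (j%:R + m%:~R) / N%:R) = \sum_(j < N) u (c + j%:R / N%:R).
Proof.
move=> N0 pu; case: m => n; first exact: periodic_sum_nat.
transitivity (\sum_(j < N) u (c - n.+1%:R / N%:R + j%:R / N%:R)).
  by apply: eq_bigr => j _; congr u; rewrite NegzE mulrNz -pmulrn; ring.
rewrite -(periodic_sum_nat (c - n.+1%:R / N%:R) n.+1 N0 pu).
by apply: eq_bigr => j _; congr u; ring.
Qed.

(** A translation by a multiple of 1/N permutes the grid; the remaining translation, by at most 1/N,
    costs K/N for each of the N terms. *)
Lemma periodic_sum_shift u N (c K : R) : (0 < N)%N -> 0 <= K ->
  (forall x, u (x + 1) = u x) -> (forall x y, `|u x - u y| <= K * `|x - y|) ->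
  `|\sum_(j < N) u (j%:R / N%:R + c) - \sum_(j < N) u (j%:R / N%:R)| <= K.
Proof.
move=> N0 K0 pu uK; have NR : 0 < N%:R :> R by rewrite ltr0n.
pose m := Num.floor (c * N%:R); pose c' := c - m%:~R / N%:R.
have c'b : 0 <= c' <= N%:R^-1.
  rewrite /c' subr_ge0 ler_pdivrMr// floor_le_tmp lerBlDl.
  rewrite -[X in _ + X]mul1r -mulrDl ler_pdivlMr//.
  by have := floorD1_gt (c * N%:R); rewrite intrD => /ltW.
have -> : \sum_(j < N) u (j%:R / N%:R + c) = \sum_(j < N) u (c' + j%:R / N%:R).
  rewrite -(periodic_sum_int c' m N0 pu); apply: eq_bigr => j _; congr u.
  by rewrite /c'; ring.
rewrite -sumrB; apply: (le_trans (ler_norm_sum _ _ _)).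
apply: (@le_trans _ _ (\sum_(j < N) (K / N%:R))).
  apply: ler_sum => j _; apply: (le_trans (uK _ _)); rewrite ler_wpM2l// addrK.
  by case/andP: c'b => c1 c2; rewrite ger0_norm.
by rewrite sumr_const card_ord -[K / _ *+ N]mulr_natr divfK ?gt_eqF.
Qed.

(* F is the composition of the vertical shear y + (x - gamma phi x), which moves
   the grid sums by O(N), and of the horizontal shear x + y, which permutes the
   grid modulo Z^2. *)
Lemma grid_sum_F phi gamma (K : R) f N : (0 < N)%N -> 0 <= K -> periodic2 f ->
  lip K f -> `|grid_sum N (f \o Fmap phi gamma) - grid_sum N f| <= 2 * K * N%:R.
Proof.
move=> N0 K0 pf fK.
have p1 (x y : R) : f (x + 1, y) = f (x, y) by have := pf (x, y) 1 0; rewrite addr0.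
have p2 (x y : R) : f (x, y + 1) = f (x, y) by have := pf (x, y) 0 1; rewrite addr0.
pose f2 (x y : R) := f (x + y, y).
have e1 : grid_sum N f = \sum_(i < N) \sum_(j < N) f2 (i%:R / N%:R) (j%:R / N%:R).
  rewrite /grid_sum exchange_big [RHS]exchange_big; apply: eq_bigr => j _ /=.
  have /= := @periodic_sum_nat (fun x => f (x, j%:R / N%:R)) N 0 j N0 (p1^~ _).
  under eq_bigr do rewrite add0r.
  under [in RHS]eq_bigr do rewrite add0r.
  by move=> <-; apply: eq_bigr => i _; rewrite /f2 mulrDl.
rewrite e1 /grid_sum -sumrB; apply: (le_trans (ler_norm_sum _ _ _)).
have -> : 2 * K * N%:R = \sum_(i < N) (2 * K).
  by rewrite sumr_const card_ord mulr_natr.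
apply: ler_sum => i _; set x := i%:R / N%:R.
have := @periodic_sum_shift (f2 x) N (x - gamma * phi x) (2 * K) N0.
rewrite mulr_ge0// => /(_ isT) H; have {}H := H _ _.
set A := (X in `|X - _|); set A' := (X in `|X - _|) in H.
suff -> : A = A' :> R.
  apply: H => [y|y z]; first by rewrite /f2 addrA p1 p2.
  apply: (le_trans (fK _ _)) => /=.
  by rewrite (_ : x + y - (x + z) = y - z); [lra|ring].
by apply: eq_bigr => j _; rewrite /f2 /= /Fmap /=; congr (f (_, _)); ring.
Qed.

Lemma grid_le_F phi gamma (K : R) f : 0 <= K -> periodic2 f -> lip K f ->
  grid_le f (f \o Fmap phi gamma) /\ grid_le (f \o Fmap phi gamma) f.
Proof.
move=> K0 pf fK; split; exists (2 * K) => N N0;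
  by have := grid_sum_F phi gamma N0 K0 pf fK; rewrite ler_norml; lra.
Qed.

End GridSums.

(** * The mean of the logarithmic contraction rate *)

Section Average.
Variables (R : realType) (phi phi1 phi2 : R -> R) (gamma B : R).
Hypothesis sp : small_perturbation phi phi1 phi2 gamma B.

Notation F := (Fmap phi gamma).

Lemma taylor_phi (a b : R) : a <= b ->
  `|phi b - phi a - phi1 a * (b - a)| <= B * (b - a) ^+ 2.
Proof.
move=> ab; have [c /andP[ac cb] ->] := is_derive_mvt ab (fun t _ => d_phi sp t).
have [d _ e] := is_derive_mvt ac (fun t _ => d_phi1 sp t).
rewrite -mulrBl e normrM expr2 mulrA (ger0_norm (_ : 0 <= b - a)) ?subr_ge0//.
rewrite ler_wpM2r ?subr_ge0// normrM (ger0_norm (_ : 0 <= c - a)) ?subr_ge0//.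
by apply: ler_pM; rewrite ?subr_ge0 ?(phi2_le sp)// lerB.
Qed.

Lemma grid_step N (i : nat) : (0 < N)%N ->
  `|phi (i.+1%:R / N%:R) - phi (i%:R / N%:R) - phi1 (i%:R / N%:R) / N%:R|
  <= B / N%:R ^+ 2.
Proof.
move=> N0; have NR : 0 < N%:R :> R by rewrite ltr0n.
have e : i.+1%:R / N%:R - i%:R / N%:R = N%:R^-1 :> R.
  by rewrite -mulrBl -natr1 addrC addKr mul1r.
have := @taylor_phi (i%:R / N%:R) (i.+1%:R / N%:R).
by rewrite e exprVn; apply; rewrite ler_pM2r ?invr_gt0// ler_nat.
Qed.

Lemma telescope_phi N m : (0 < N)%N ->
  `|phi (m%:R / N%:R) - phi 0 - \sum_(i < m) phi1 (i%:R / N%:R) / N%:R|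
  <= m%:R * (B / N%:R ^+ 2).
Proof.
move=> N0; elim: m => [|m ih].
  by rewrite big_ord0 !mul0r !subrr normr0.
rewrite big_ord_recr /= -[in leRHS]natr1 mulrDl mul1r.
rewrite (_ : _ - _ = (phi (m%:R / N%:R) - phi 0 - \sum_(i < m) phi1 (i%:R / N%:R) / N%:R)
  + (phi (m.+1%:R / N%:R) - phi (m%:R / N%:R) - phi1 (m%:R / N%:R) / N%:R)); last by ring.
by apply: (le_trans (ler_normD _ _)); apply: lerD => //; exact: grid_step.
Qed.

Lemma sum_phi1_le N : (0 < N)%N -> `|\sum_(i < N) phi1 (i%:R / N%:R)| <= B.
Proof.
move=> N0; have NR : 0 < N%:R :> R by rewrite ltr0n.
have := telescope_phi N N0; rewrite divff ?gt_eqF// -mulr_suml.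
have -> : phi 1 = phi 0 by rewrite -[1]add0r (per_phi sp).
rewrite subrr add0r normrN normrM (ger0_norm (_ : 0 <= N%:R^-1)) ?invr_ge0//.
rewrite ler_pdivrMr//; set S := `|_|.
by rewrite (_ : N%:R * _ * N%:R = B); [|field; rewrite gt_eqF].
Qed.

(** Discrete form of: the integral of phi'^2 is at least the square of that of |phi'|, which is at
    least |phi x0 - phi 0|. Cauchy-Schwarz is used in the linearised form z^2 >= 2 D z - D^2. *)
Lemma sum_phi1_sqr_ge (x0 : R) : exists2 C : R, 0 <= C & forall N, (0 < N)%N ->
  N%:R * (phi x0 - phi 0) ^+ 2 - C <= \sum_(i < N) phi1 (i%:R / N%:R) ^+ 2.
Proof.
set D := `|phi x0 - phi 0|; have B0 := B_ge0 sp.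
have D0 : 0 <= D by exact: normr_ge0.
exists (4 * B * D); first by rewrite !mulr_ge0.
move=> N N0; have NR : 0 < N%:R :> R by rewrite ltr0n.
pose x1 := x0 + (- Num.floor x0)%:~R.
have ex1 : phi x1 = phi x0 by rewrite /x1 (periodic_int (per_phi sp)).
have x10 : 0 <= x1 by rewrite /x1 mulrNz subr_ge0 floor_le_tmp.
have x11 : x1 < 1.
  by have := floorD1_gt x0; rewrite intrD /x1 mulrNz ltrBlDl.
(* The grid point m/N just below x1, so that a partial sum of the grid reaches phi x1 up to B/N. *)
pose m := Num.truncn (x1 * N%:R).
have /andP[m1 m2] : m%:R <= x1 * N%:R < m.+1%:R.
  by apply: truncn_itv; rewrite mulr_ge0 ?(ltW NR).
have mN : (m <= N)%N.
  rewrite -(ler_nat R); apply: le_trans m1 _.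
  by rewrite -[leRHS]mul1r; apply: ler_wpM2r; apply: ltW.
have close : `|phi x1 - phi (m%:R / N%:R)| <= B / N%:R.
  have mx : m%:R / N%:R <= x1 by rewrite ler_pdivrMr.
  have [c _ ->] := is_derive_mvt mx (fun t _ => d_phi sp t).
  rewrite normrM; apply: ler_pM => //; first exact: phi1_le sp c.
  rewrite ger0_norm ?subr_ge0// lerBlDr -[X in X + _]mul1r -mulrDl.
  by rewrite ler_pdivlMr// addrC natr1 ltW.
have tel := telescope_phi m N0.
have mB : m%:R * (B / N%:R ^+ 2) <= B / N%:R.
  rewrite (_ : B / N%:R = N%:R * (B / N%:R ^+ 2)); last by field; rewrite gt_eqF.
  by rewrite ler_wpM2r ?ler_nat// divr_ge0// exprn_ge0// ltW.
pose S := \sum_(i < N) `|phi1 (i%:R / N%:R)|.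
have SN : `|\sum_(i < m) phi1 (i%:R / N%:R) / N%:R| <= S / N%:R.
  rewrite -mulr_suml normrM (ger0_norm (_ : 0 <= N%:R^-1)) ?invr_ge0 ?(ltW NR)//.
  rewrite ler_wpM2r ?invr_ge0 ?(ltW NR)//; apply: (le_trans (ler_norm_sum _ _ _)).
  rewrite /S (big_ord_widen N (fun i => `|phi1 (i%:R / N%:R)|))// big_mkcond /=.
  by apply: ler_sum => i _; case: ifP.
have DS : D - 2 * (B / N%:R) <= S / N%:R.
  have : D <= `|phi x1 - phi (m%:R / N%:R)| + `|phi (m%:R / N%:R) - phi 0 -
      \sum_(i < m) phi1 (i%:R / N%:R) / N%:R| + `|\sum_(i < m) phi1 (i%:R / N%:R) / N%:R|.
    rewrite /D -ex1; set z := \sum_(i < m) _; set w := phi (m%:R / _).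
    rewrite (_ : phi x1 - phi 0 = (phi x1 - w) + (w - phi 0 - z) + z); last by ring.
    by apply: (le_trans (ler_normD _ _)); rewrite lerD2r; exact: ler_normD.
  lra.
have key : 2 * D * S - N%:R * D ^+ 2 <= \sum_(i < N) phi1 (i%:R / N%:R) ^+ 2.
  have -> : N%:R * D ^+ 2 = \sum_(i < N) D ^+ 2 by rewrite sumr_const card_ord mulr_natl.
  rewrite /S mulr_sumr -sumrB; apply: ler_sum => i _.
  rewrite -[phi1 _ ^+ 2]real_normK ?num_real//.
  by have := sqr_ge0 (`|phi1 (i%:R / N%:R)| - D); rewrite sqrrB; lra.
have {}DS : N%:R * D - 2 * B <= S.
  have := ler_wpM2r (ltW NR) DS; rewrite divfK ?gt_eqF// mulrBl -mulrA divfK ?gt_eqF//.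
  lra.
apply: le_trans key; rewrite -[(_ - _) ^+ 2]real_normK ?num_real// -/D.
by have := ler_wpM2l D0 DS; nra.
Qed.

Definition gphi1 (p : R * R) := gamma * phi1 p.1.

Lemma grid_sum_fst N (u : R -> R) :
  grid_sum N (fun p => u p.1) = N%:R * \sum_(i < N) u (i%:R / N%:R).
Proof.
rewrite /grid_sum mulr_sumr; apply: eq_bigr => i _ /=.
by rewrite sumr_const card_ord -[LHS]mulr_natl.
Qed.

Lemma grid_le_gphi1 : grid_le (fun=> 0) gphi1.
Proof.
exists (gamma * B) => N N0; rewrite grid_sum_cst mul0r grid_sumZ (grid_sum_fst N phi1).
have := sum_phi1_le N0; rewrite ler_norml => /andP[h _].
have NR : 0 <= N%:R :> R by [].
have := ler_wpM2l (gamma_ge0 sp) (ler_wpM2l NR h); lra.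
Qed.

Lemma grid_le_gphi1_sqr (x0 : R) :
  grid_le (fun=> gamma ^+ 2 * (phi x0 - phi 0) ^+ 2) (fun p => gphi1 p ^+ 2).
Proof.
have [C C0 H] := sum_phi1_sqr_ge x0.
exists (gamma ^+ 2 * C) => N N0; rewrite grid_sum_cst.
rewrite (_ : (fun p => _) = (fun p => gamma ^+ 2 * (phi1 p.1 ^+ 2))); last first.
  by apply/funext => p; rewrite exprMn.
rewrite grid_sumZ (grid_sum_fst N (fun x => phi1 x ^+ 2)).
have NR : 0 <= N%:R :> R by [].
have := ler_wpM2l (sqr_ge0 gamma) (ler_wpM2l NR (H N N0)); nra.
Qed.

Lemma lip_F (K : R) (f : R * R -> R) : 0 <= K -> lip K f -> lip (5 * K) (f \o F).
Proof.
move=> K0 fK p q; apply: (le_trans (fK _ _)); rewrite [5 * K]mulrC -mulrA ler_wpM2l//.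
have gp : `|gamma * phi p.1 - gamma * phi q.1| <= `|p.1 - q.1|.
  wlog pq : p q / p.1 <= q.1.
    move=> W; have [h|/ltW h] := leP p.1 q.1; first exact: W.
    by rewrite distrC (distrC p.1); exact: W.
  rewrite distrC (distrC p.1) -mulrBr.
  have [c _ ->] := is_derive_mvt pq (fun t _ => d_phi sp t).
  rewrite mulrA normrM ler_piMl//; apply: le_trans (gphi1_le sp c) _.
  by have := gammaB_le sp; lra.
rewrite /Fmap /=; move: gp; set a := gamma * phi p.1; set b := gamma * phi q.1.
rewrite (_ : 2 * p.1 + p.2 - a - _ = (p.1 - q.1) + (p.1 - q.1) + (p.2 - q.2) - (a - b)); last by ring.
rewrite (_ : p.1 + p.2 - a - _ = (p.1 - q.1) + (p.2 - q.2) - (a - b)); last by ring.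
set x := p.1 - q.1; set y := p.2 - q.2; set z := a - b => zx.
have := ler_normB (x + x + y) z; have := ler_normB (x + y) z.
have := ler_normD (x + x) y; have := ler_normD x y; have := ler_normD x x.
have := normr_ge0 y; lra.
Qed.

Lemma lip_iter_F (K : R) (f : R * R -> R) n : 0 <= K -> lip K f ->
  exists2 K' : R, 0 <= K' & lip K' (f \o iter n F).
Proof.
move=> K0 fK; elim: n => [|n [K' K'0 ih]]; first by exists K.
exists (5 * K'); first by rewrite mulr_ge0.
have := lip_F K'0 ih; rewrite (_ : _ \o F = f \o iter n.+1 F)//.
by apply/funext => p /=; rewrite -iterSr.
Qed.

Lemma lip_g : lip (gamma * B) gphi1.
Proof.
move=> p q; rewrite /gphi1.
wlog pq : p q / p.1 <= q.1.
  move=> W; have [h|/ltW h] := leP p.1 q.1; first exact: W.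
  by rewrite distrC (distrC p.1) (distrC p.2); exact: W.
rewrite distrC (distrC p.1) -mulrBr.
have [c _ ->] := is_derive_mvt pq (fun t _ => d_phi1 sp t).
rewrite mulrA normrM; apply: ler_pM => //; first exact: gphi2_le sp c.
by rewrite lerDl.
Qed.

Lemma periodic2_g : periodic2 gphi1.
Proof. by move=> p m n; rewrite /gphi1 /= (periodic_int (per_phi1 sp)). Qed.

Variable V : R * R -> R * R.
Hypothesis sV : stable_unit_field (Fmap phi gamma) V.
Notation kap := (kap phi1 gamma V).
Notation birkhoff := (birkhoff phi phi1 gamma V).
Notation lam := (lam R).

Lemma lip_kap : lip 1 kap.
Proof.
have gB := gammaB_le sp; have gB0 := gammaB_ge0 sp.
apply: has_grad_lip (grad_kap sp sV) _ _ => p; have [sx sy] := grad_slope_le sp sV p.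
  by apply: (le_trans (ler_normB _ _)); rewrite normrN; have := gphi2_le sp p.1; lra.
by rewrite normrN; lra.
Qed.

Lemma lip_ln_kap : lip 4 (fun p => ln (kap p)).
Proof.
have key p q : ln (kap p) - ln (kap q) <= 4 * `|kap p - kap q|.
  apply: le_trans (ln_diff_le (kap_gt0 sp sV p) (kap_gt0 sp sV q)) _.
  have kq := kap_ge sp sV q; rewrite ler_pdivrMr ?(kap_gt0 sp sV)//.
  have := ler_norm (kap p - kap q); have := normr_ge0 (kap p - kap q).
  by move: kq; set a := kap q; set b := `|_|; nra.
move=> p q; apply: (@le_trans _ _ (4 * `|kap p - kap q|)).
  by rewrite ler_norml; have := key p q; have := key q p; rewrite (distrC (kap q)); lra.
by rewrite ler_wpM2l// -[leRHS]mul1r; exact: lip_kap.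
Qed.

(** Start from ln x >= 1 - 1/x at x = kap / lam. The last bracket equals 3 - kap - 1/kap, and 1 / (3
    - 2 lam) is the multiple of it that has the same tangent as 1 - lam / kap at [lam]; subtracting
    it leaves a pure square, whose coefficient is at least 1 because kap (3 - 2 lam) <= 1. As a
    coboundary plus gamma phi' along F, the bracket has mean zero. *)
Lemma ln_kap_ge p : ln lam + (kap p - lam) ^+ 2 +
  (3 - 2 * lam)^-1 * (- kap p + kap (F p) + gphi1 (F p)) <= ln (kap p).
Proof.
have k0 := kap_gt0 sp sV p; have k1 := kap_le sp sV p.
have lb := @lam_bounds R; have l0 : 0 < lam :> R by lra.
have s0 : 0 < 3 - 2 * lam :> R by lra.
have kV : (kap p)^-1 = 3 - gphi1 (F p) - kap (F p).
  apply: (mulfI (lt0r_neq0 k0)).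
  by rewrite divff ?gt_eqF// /gphi1 (kap_rec sp sV).
have := ln_ge1V (divr_gt0 k0 l0); rewrite ln_div ?posrE// invf_div => h.
have -> : - kap p + kap (F p) + gphi1 (F p) = 3 - kap p - (kap p)^-1 by rewrite kV; ring.
have e : 1 - lam / kap p = (kap p - lam) ^+ 2 / (kap p * (3 - 2 * lam)) +
    (3 - 2 * lam)^-1 * (3 - kap p - (kap p)^-1).
  have -> : (kap p - lam) ^+ 2 = (kap p - lam) * (3 - 2 * lam) + kap p ^+ 2 - 3 * kap p
      + lam * (3 - lam) by ring.
  by rewrite lamE; field; rewrite !gt_eqF.
have : (kap p - lam) ^+ 2 <= (kap p - lam) ^+ 2 / (kap p * (3 - 2 * lam)).
  rewrite ler_peMr ?sqr_ge0// -[leLHS]invr1 lef_pV2 ?posrE ?mulr_gt0//.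
  by nra.
lra.
Qed.

(** The recursion [kap_rec] writes gamma phi' as a combination of the deviations of [kap] from [lam]
    at p and F p, so a nonzero perturbation forces deviation. 242 = 2 * 11^2, where 1/11 <= kap lam;
    averaging gives 244 = 2 + 242. *)
Lemma gphi1_sqr_le p : gphi1 (F p) ^+ 2 <=
  2 * (kap (F p) - lam) ^+ 2 + 242 * (kap p - lam) ^+ 2.
Proof.
have k0 := kap_gt0 sp sV p; have k1 := kap_ge sp sV p.
have lb := @lam_bounds R; have l0 : 0 < lam :> R by lra.
pose w := (kap p - lam) / (kap p * lam).
have -> : gphi1 (F p) = - (kap (F p) - lam) + w.
  apply: (mulfI (lt0r_neq0 (mulr_gt0 k0 l0))).
  rewrite mulrDr /w [X in _ + X]mulrC divfK ?(gt_eqF (mulr_gt0 k0 l0))//.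
  transitivity (lam * (kap p * (3 - kap (F p)) - kap p * (3 - gphi1 (F p) - kap (F p)))).
    by ring.
  rewrite [X in _ - X](kap_rec sp sV); apply: subr0_eq.
  rewrite [LHS](_ : _ = kap p * (lam * (3 - lam) - 1)); last by ring.
  by rewrite lamE subrr mulr0.
have : w ^+ 2 <= 121 * (kap p - lam) ^+ 2.
  have z0 : 11^-1 <= kap p * lam by nra.
  rewrite /w exprMn exprVn; move: z0; set z := kap p * lam; set u := _ ^+ 2 => z0.
  have zz : 121^-1 <= z ^+ 2 by nra.
  rewrite ler_pdivrMr; last by nra.
  have : 0 <= u by exact: sqr_ge0.
  by move: zz; set y := z ^+ 2; nra.
have := sqr_ge0 (kap (F p) - lam + w); nra.
Qed.

Lemma grid_le_ln_kap (x0 : R) :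
  grid_le (fun=> ln lam + gamma ^+ 2 * (phi x0 - phi 0) ^+ 2 / 244) (fun p => ln (kap p)).
Proof.
have gB := gammaB_le sp; have gB0 := gammaB_ge0 sp.
have pk := periodic2_kap sp sV.
pose e p := (kap p - lam) ^+ 2.
have lb := @lam_bounds R.
have le : lip (2 * 1) e.
  apply: (@lip_sqr _ 1 (fun p => kap p - lam)) => [p q|p].
    by rewrite opprB addrA subrK; exact: lip_kap.
  by rewrite ler_norml; have := kap_gt0 sp sV p; have := kap_le sp sV p; lra.
have pe : periodic2 e by move=> p m n; rewrite /e pk.
have lg : lip (2 * (gamma * B)) (fun p => gphi1 p ^+ 2).
  by apply: lip_sqr lip_g _ => p; have := gphi1_le sp p.1; rewrite /gphi1; lra.
have pg : periodic2 (fun p => gphi1 p ^+ 2) by move=> p m n; rewrite periodic2_g.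
have [g1 _] := grid_le_F phi gamma (mulr_ge0 (ler0n R 2) gB0) pg lg.
have [_ e1] := grid_le_F phi gamma (mulr_ge0 (ler0n R 2) ler01) pe le.
have [k1 _] := grid_le_F phi gamma ler01 pk lip_kap.
have [g2 _] := grid_le_F phi gamma gB0 periodic2_g lip_g.
have he : grid_le (fun=> gamma ^+ 2 * (phi x0 - phi 0) ^+ 2 / 244) e.
  have h : grid_le (fun=> gamma ^+ 2 * (phi x0 - phi 0) ^+ 2) (fun p => 244 * e p).
    apply: grid_le_trans (grid_le_gphi1_sqr x0) _; apply: grid_le_trans g1 _.
    apply: (@grid_le_trans _ (fun p => 2 * e (F p) + 242 * e p)).
      by apply: grid_le_le => p; exact: gphi1_sqr_le.
    apply: grid_le_trans (grid_leD (grid_leZ (ler0n R 2) e1) (grid_le_refl (fun p => 242 * e p))) _.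
    by apply: grid_le_le => p; rewrite /=; lra.
  have c0 : 0 <= 244^-1 :> R by rewrite invr_ge0.
  have h' := grid_leZ c0 h.
  apply: (@grid_le_trans _ (fun p => 244^-1 * (244 * e p))).
    by apply: grid_le_trans h'; apply: grid_le_le => p; lra.
  by apply: grid_le_le => p; lra.
have hz : grid_le (fun=> 0) (fun p => - kap p + kap (F p) + gphi1 (F p)).
  apply: (@grid_le_trans _ (fun p => - kap p + kap p + gphi1 p)).
    by apply: grid_le_trans grid_le_gphi1 _; apply: grid_le_le => p; rewrite addNr add0r.
  exact: grid_leD (grid_leD (grid_le_refl _) k1) g2.
have sV0 : 0 <= (3 - 2 * lam)^-1 :> R by rewrite invr_ge0; lra.
apply: (@grid_le_trans _ (fun p => ln lam + e p + (3 - 2 * lam)^-1 *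
    (- kap p + kap (F p) + gphi1 (F p)))); last by apply: grid_le_le => p; exact: ln_kap_ge.
apply: grid_le_trans (grid_leD (grid_leD (grid_le_refl (fun=> ln lam)) he) (grid_leZ sV0 hz)).
by apply: grid_le_le => p; rewrite mulr0 addr0.
Qed.

(** Each composition with F adds a grid error that depends on n; this is harmless, since n is fixed
    while the grid is refined. *)
Lemma grid_le_birkhoff (x0 : R) n :
  grid_le (fun=> n%:R * (ln lam + gamma ^+ 2 * (phi x0 - phi 0) ^+ 2 / 244)) (birkhoff n).
Proof.
set a := ln lam + _.
have hk k : grid_le (fun=> a) (fun p => ln (kap (iter k F p))).
  elim: k => [|k ih]; first exact: grid_le_ln_kap.
  have [K' K'0 lK] := lip_iter_F k (ler0n R 4) lip_ln_kap.
  have pK : periodic2 ((fun p => ln (kap p)) \o iter k F).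
    apply: (periodic2_iter_F sp) => p i j; by rewrite (periodic2_kap sp sV).
  have [h _] := grid_le_F phi gamma K'0 pK lK.
  apply: grid_le_trans ih _; apply: grid_le_trans h _.
  by apply: grid_le_le => p; rewrite /= -iterSr.
elim: n => [|n ih].
  by apply: grid_le_le => p; rewrite birkhoff0 mul0r.
apply: (@grid_le_trans _ (fun=> n%:R * a + a)).
  by apply: grid_le_le => p; rewrite -natr1 mulrDl mul1r.
apply: grid_le_trans (grid_leD ih (hk n)) _; apply: grid_le_le => p.
by rewrite birkhoffSr.
Qed.

Lemma birkhoff_sup (x0 : R) n (d : R) :
  0 < d -> d < gamma ^+ 2 * (phi x0 - phi 0) ^+ 2 / 244 -> (0 < n)%N ->
  exists y, n%:R * (ln lam + d) < birkhoff n y.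
Proof.
move=> d0 dl n0; apply: grid_le_cst_ex (grid_le_birkhoff x0 n) _.
by rewrite ltr_pM2l ?ltr0n// ltrD2l.
Qed.

End Average.

(** * Slow points and crossings *)

Section Extremes.
Variables (R : realType) (phi phi1 phi2 : R -> R) (gamma B : R).
Hypothesis sp : small_perturbation phi phi1 phi2 gamma B.
Variable V : R * R -> R * R.
Hypothesis sV : stable_unit_field (Fmap phi gamma) V.
Variable Phi : R -> R * R -> R * R.
Hypothesis flowV : flow_of V Phi.

Notation F := (Fmap phi gamma).
Notation slope := (slope V).
Notation kap := (kap phi1 gamma V).
Notation kprod := (kprod phi phi1 gamma V).
Notation birkhoff := (birkhoff phi phi1 gamma V).
Notation lam := (lam R).
Notation curve n xi s := (iter n F (Phi s xi)).
Notation speed := (speed phi phi1 gamma V Phi).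

(** The left eigenvector, for the eigenvalue [lam], of the linear part of F. *)
Let ell (p : R * R) := p.1 - (2 - lam) * p.2.

Lemma ell_F p : ell (F p) = lam * ell p + (1 - lam) * (gamma * phi p.1).
Proof.
apply: subr0_eq; rewrite /ell /Fmap /=.
rewrite [LHS](_ : _ = p.2 * (lam * (3 - lam) - 1)); last by ring.
by rewrite lamE subrr mulr0.
Qed.

(** The factor 1 - lam of the perturbation in [ell_F] is offset by the geometric series in [lam], so
    the error does not depend on n. *)
Lemma ell_iter_F (M : R) p q n : (forall x, `|phi x| <= M) ->
  `|ell (iter n F p) - ell (iter n F q)| <=
  lam ^+ n * `|ell p - ell q| + 2 * (gamma * M).
Proof.
move=> phiM; have g0 := gamma_ge0 sp; have lb := @lam_bounds R.
have gM x : `|gamma * phi x| <= gamma * M.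
  by rewrite normrM ger0_norm// ler_wpM2l.
have M0 : 0 <= gamma * M by exact: le_trans (normr_ge0 _) (gM 0).
have l0 : 0 <= lam by lra.
elim: n => [|n ih]; first by rewrite expr0 mul1r lerDl mulr_ge0.
rewrite !iterS !ell_F; set x := ell (iter n F p) in ih *; set y := ell _ in ih *.
set a := gamma * phi _; set b := gamma * phi _.
rewrite (_ : _ - _ = lam * (x - y) + (1 - lam) * (a - b)); last by ring.
apply: (le_trans (ler_normD _ _)); rewrite (normrM lam) (normrM (1 - lam)).
rewrite (ger0_norm l0) (ger0_norm (_ : 0 <= 1 - lam)); last by lra.
have ab : `|a - b| <= 2 * (gamma * M).
  by apply: (le_trans (ler_normB _ _)); have := gM (iter n F p).1;
     have := gM (iter n F q).1; rewrite -/a -/b; lra.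
have h1 := ler_wpM2l l0 ih.
have h2 : (1 - lam) * `|a - b| <= (1 - lam) * (2 * (gamma * M)).
  by rewrite ler_wpM2l//; lra.
by rewrite exprS; lra.
Qed.

Lemma d_ell_curve n xi (t : R) : is_derive t 1 (fun s => ell (curve n xi s))
  (speed n xi t * (1 + (2 - lam) * slope (curve n xi t))).
Proof.
have [d1 d2] := d_curve sp sV flowV n xi t.
by apply: (is_derive_eq (is_derive_sub d1 (is_derive_scale (2 - lam) d2))); ring.
Qed.

Lemma ell_curve n xi (t : R) : 0 <= t ->
  3 * ((curve n xi t).1 - (iter n F xi).1) <= ell (curve n xi t) - ell (iter n F xi)
    <= 5 * ((curve n xi t).1 - (iter n F xi).1).
Proof.
move=> t0; have P0 : Phi 0 xi = xi by case: flowV.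
have d1 (k s : R) : is_derive s 1 (fun s => k * (curve n xi s).1) (k * speed n xi s).
  by apply: is_derive_scale; have [] := d_curve sp sV flowV n xi s.
have lb := @lam_bounds R.
have sl (s : R) : 3 <= 1 + (2 - lam) * slope (curve n xi s) <= 5.
  by have := slope_bounds sp sV (curve n xi s); set r := slope _; nra.
have sp0 s := speed_gt0 sp sV Phi n xi s.
rewrite !mulrBr; apply/andP; split.
  have := derive_le_le t0 (fun s _ => d1 3 s) (fun s _ => d_ell_curve n xi s).
  rewrite P0; apply => s _; rewrite mulrC ler_wpM2l ?(ltW (sp0 s))//.
  by have /andP[] := sl s.
have := derive_le_le t0 (fun s _ => d_ell_curve n xi s) (fun s _ => d1 5 s).
rewrite P0; apply => s _; rewrite [leRHS]mulrC ler_wpM2l ?(ltW (sp0 s))//.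
by have /andP[] := sl s.
Qed.

(* A stable arc of first-coordinate extent D is sent by F^n to one of extent at
   most (5/3) lam^n D + O(1), since [ell] is a left eigenvector up to O(1);
   so the contraction cannot exceed 3 lam^n everywhere. *)
Lemma birkhoff_inf n : exists x, birkhoff n x <= n%:R * ln lam + ln 3.
Proof.
apply: contrapT => no; have lb := @lam_bounds R; have l0 : 0 < lam by lra.
have kb x : 3 * lam ^+ n <= kprod n x.
  have k0 := kprod_gt0 sp sV n x.
  rewrite -ler_ln ?posrE ?mulr_gt0 ?exprn_gt0// lnM ?posrE ?exprn_gt0// lnXn//.
  rewrite (ln_kprod sp sV) leNgt; apply/negP => h; apply: no; exists x.
  by rewrite mulr_natl addrC ltW.
have [M HM] : exists M : R, forall x, `|phi x| <= M.
  by apply: periodic_bounded (per_phi sp) _ => x; exact: is_derive_continuous (d_phi sp x).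
(* The arc is taken so long that the O(1) error is below lam^n t: the inequalities give 9 lam^n D <=
   5 lam^n D + 2 gamma M with D >= 2t/5. *)
have [t tM] := exists_natr_gt (2 * (gamma * M) / lam ^+ n).
have ln0 : 0 < lam ^+ n by rewrite exprn_gt0.
rewrite ltr_pdivrMr// in tM.
pose xi : R * R := (0, 0); have P0 : Phi 0 xi = xi by case: flowV.
have t0 : 0 <= t%:R :> R by [].
have /andP[d1 _] := ell_curve n xi t0; have /andP[d3 d2] := ell_curve 0 xi t0.
have := ell_iter_F (Phi t%:R xi) xi n HM.
have /andP[+ _] := curve_disp sp sV flowV 0 xi t0.
have dd := derive_le_le t0
  (fun s _ => is_derive_scale (3 * lam ^+ n) (d_curve sp sV flowV 0 xi s).1)
  (fun s _ => (d_curve sp sV flowV n xi s).1).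
have {dd} : 3 * lam ^+ n * ((Phi t%:R xi).1 - xi.1) <=
     (curve n xi t%:R).1 - (iter n F xi).1.
  rewrite mulrBr; move: dd; rewrite P0; apply => s _.
  rewrite /speed kprod0 mul1r ler_wpM2r// ltW//; exact: V1_gt0 sV _.
move: d1 d2 d3 => /=; set Dn := _ - (iter n F xi).1; set D0 := _ - xi.1.
set en := ell (iter n F _) - _; set e0 := ell (Phi _ _) - _ => d1 d2 d3 h1.
rewrite expr0 mulr1 => h2.
have e00 : 0 <= e0 by lra.
have en0 : 0 <= en by have := mulr_ge0 (ltW ln0) (_ : 0 <= D0); lra.
rewrite (ger0_norm e00) (ger0_norm en0) => h3.
have h4 := ler_wpM2l (ltW ln0) d2.
have h5 := ler_wpM2l (ltW ln0) h2.
lra.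
Qed.

Lemma lip_birkhoff n : exists2 K : R, 0 <= K & lip K (birkhoff n).
Proof.
elim: n => [|n [K K0 ih]].
  by exists 0 => // p q; rewrite !birkhoff0 subrr normr0 mul0r.
have [K' K'0 lK] := lip_iter_F sp n (ler0n R 4) (lip_ln_kap sp sV).
exists (K + K'); first exact: addr_ge0.
move=> p q; rewrite !birkhoffSr opprD addrACA mulrDl.
by apply: (le_trans (ler_normD _ _)); apply: lerD; [exact: ih|exact: lK].
Qed.

Lemma lip_continuous (K : R) (f : R * R -> R) (x : R * R) : 0 <= K -> lip K f ->
  f @ x --> f x.
Proof.
move=> K0 fK; apply/cvgrPdist_le => e e0.
pose d := e / (2 * (K + 1)).
have d0 : 0 < d by rewrite divr_gt0// mulr_gt0// ltr_wpDl.
have c1 : (fun y : R * R => y.1) @ x --> x.1 by exact: cvg_fst.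
have c2 : (fun y : R * R => y.2) @ x --> x.2 by exact: cvg_snd.
move/cvgrPdist_le: c1 => /(_ d d0) n1; move/cvgrPdist_le: c2 => /(_ d d0) n2.
near=> y; apply: (le_trans (fK x y)).
have h1 : `|x.1 - y.1| <= d by near: y; exact: n1.
have h2 : `|x.2 - y.2| <= d by near: y; exact: n2.
have -> : e = d * (2 * (K + 1)).
  by rewrite /d divfK// gt_eqF// mulr_gt0// ltr_wpDl.
nra.
Unshelve. all: by end_near. Qed.

Lemma birkhoff_ge n p : - n%:R * ln 4 <= birkhoff n p.
Proof.
rewrite -(ln_kprod sp sV) mulNr mulr_natl -lnXn// -lnV ?posrE ?exprn_gt0//.
rewrite ler_ln ?posrE ?invr_gt0 ?exprn_gt0 ?(kprod_gt0 sp sV)// -exprVn.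
by have /andP[] := kprod_bounds sp sV n p.
Qed.

(* Otherwise every orbit is a concatenation of blocks of bounded length (by
   compactness) with large Birkhoff sums, against [birkhoff_inf]. *)
Lemma slow_point (e : R) : 0 < e ->
  exists x, forall k, (0 < k)%N -> birkhoff k x <= k%:R * (ln lam + e).
Proof.
move=> e0; apply: contrapT => no; set a := ln lam + e.
have ex x : exists2 k, (0 < k)%N & k%:R * a < birkhoff k x.
  apply: contrapT => h; apply: no; exists x => k k0.
  by rewrite leNgt; apply/negP => h'; apply: h; exists k.
have [K HK] : exists K : nat, forall x, exists k,
    [/\ (0 < k)%N, (k <= K)%N & k%:R * a < birkhoff k x].
  pose P (K : nat) (x : R * R) :=
    exists k, [/\ (0 < k)%N, (k <= K)%N & k%:R * a < birkhoff k x].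
  have cpt : compact (`[0, 1] `*` `[0, 1] : set (R * R)).
    by apply: compact_setX; exact: segment_compact.
  move/compact_near_coveringP: cpt => /(_ nat \oo P _).
  case=> [x _|K _ HK].
    have [k k0 ka] := ex x; have [L L0 lL] := lip_birkhoff k.
    have nb : \forall y \near x, k%:R * a < birkhoff k y.
      exact: (cvgr_gt _ (lip_continuous (x := x) L0 lL) _ ka).
    exists ([set y | k%:R * a < birkhoff k y], [set K | (k <= K)%N]) => /=.
      by split; [exact: nb|exists k].
    by move=> [y K] /= [h1 h2]; exists k; split.
  exists K => x.
  pose i := - Num.floor x.1; pose j := - Num.floor x.2.
  have b (z : R) : 0 <= z + (- Num.floor z)%:~R <= 1.
    rewrite mulrNz subr_ge0 floor_le_tmp lerBlDl.
    by have := floorD1_gt z; rewrite intrD => /ltW; rewrite addrC.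
  have [|k [k0 kK]] := HK K (leqnn K) (x.1 + i%:~R, x.2 + j%:~R).
    by split; rewrite /= in_itv /= b.
  by rewrite (periodic2_birkhoff sp sV) => h; exists k.
have lb := @lam_bounds R.
have l4 : 0 <= ln 4 :> R by rewrite ln_ge0//; lra.
(* The cost of a last incomplete block, of length at most K, on which each term is at least - ln
   4. *)
pose C := K%:R * (ln 4 + `|a|).
have low n x : n%:R * a - C <= birkhoff n x.
  elim/ltn_ind: n x => n ih x; have [nK|Kn] := leqP n K.
    have := birkhoff_ge n x; have nKR : n%:R <= K%:R :> R by rewrite ler_nat.
    have n0 : 0 <= n%:R :> R by [].
    have := ler_norm a; have := normr_ge0 a; rewrite /C.
    move: nKR n0; set N := n%:R; set A := `|a|; set L := ln 4 in l4 *; set M := K%:R.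
    move=> h1 h2 h3 h4 h5.
    have h6 : N * a <= M * A by nra.
    have h7 : N * L <= M * L by nra.
    lra.
  have [k [k0 kK ka]] := HK x.
  have kn : (k <= n)%N by exact: leq_trans kK (ltnW Kn).
  have := ih (n - k)%N _ (iter k F x); rewrite ltn_subrL k0 (leq_trans k0 kn).
  move=> /(_ isT).
  have -> : birkhoff n x = birkhoff k x + birkhoff (n - k) (iter k F x).
    by rewrite -birkhoffD subnKC.
  by rewrite natrB//; lra.
have [n hn] := exists_natr_gt ((C + ln 3) / e).
have [x hx] := birkhoff_inf n; have := low n x; rewrite /a.
by move: hn; rewrite ltr_pdivrMr//; set N := n%:R in hx *; lra.
Qed.

(** A cone of displacements that F preserves and stretches horizontally by 19/10. It excludes the
    stable direction, of slope below - 3/2, and its curves stand in for unstable manifolds. *)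
Definition cone (p q : R * R) := 0 <= q.2 - p.2 <= q.1 - p.1.

Lemma cone_F p q : cone p q -> cone (F p) (F q) /\
  19 / 10 * (q.1 - p.1) <= (F q).1 - (F p).1.
Proof.
rewrite /cone /Fmap /= => /andP[c1 c2].
have pq : p.1 <= q.1 by lra.
have gp : `|gamma * phi q.1 - gamma * phi p.1| <= 50^-1 * (q.1 - p.1).
  rewrite -mulrBr; have [c _ ->] := is_derive_mvt pq (fun t _ => d_phi sp t).
  rewrite mulrA normrM [X in _ * X]ger0_norm ?subr_ge0// ler_wpM2r ?subr_ge0//.
  exact: le_trans (gphi1_le sp c) (gammaB_le sp).
move: gp; rewrite ler_norml; set a := gamma * phi q.1; set b := gamma * phi p.1.
move=> /andP[g1 g2].
by split; [apply/andP; split|]; lra.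
Qed.

Lemma cone_iter p q n : cone p q -> cone (iter n F p) (iter n F q) /\
  q.1 - p.1 <= (iter n F q).1 - (iter n F p).1.
Proof.
move=> c; elim: n => [|n [ih1 ih2]]; first by split.
have [h1 h2] := cone_F ih1; split => //; rewrite !iterS.
by apply: le_trans h2; move: ih1 => /andP[]; lra.
Qed.

(** Seen from time n, earlier extents decay geometrically. The constant 10 closes the induction:
    step n adds at most 4 * 2 extents, and 10 + 8 <= 10 * 19/10. *)
Lemma cone_birkhoff p q n : cone p q ->
  `|birkhoff n q - birkhoff n p| <= 10 * ((iter n F q).1 - (iter n F p).1).
Proof.
move=> c; elim: n => [|n ih].
  by rewrite !birkhoff0 subrr normr0 mulr_ge0//; case/andP: c => /le_trans /[apply].
rewrite !birkhoffSr opprD addrACA; apply: (le_trans (ler_normD _ _)).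
have [cn _] := cone_iter n c; have [_ h] := cone_F cn.
have := lip_ln_kap sp sV (iter n F q) (iter n F p).
move: cn => /andP[c1 c2].
rewrite (ger0_norm c1) (ger0_norm (le_trans c1 c2)) !iterS; lra.
Qed.

(** F^n turns a horizontal segment at y into a rising graph over an interval of length at least 1,
    while the image of the flow line of x falls with slope below -1. After an integer translation
    the two must cross over a unit window, and the crossing is pulled back by F^n. *)
Lemma crossing x y n : exists t s : R,
  [/\ 0 <= t, 1 <= (curve n x t).1 - (iter n F x).1 <= 3, 0 <= s,
      (iter n F (y.1 + s, y.2)).1 - (iter n F y).1 <= 1 &
      birkhoff n (Phi t x) = birkhoff n (y.1 + s, y.2)].
Proof.
have P0 : Phi 0 x = x by case: flowV.
pose p s := (y.1 + s, y.2).
have cp (s s' : R) : s <= s' -> cone (p s) (p s').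
  by move=> h; rewrite /cone /= subrr lexx /=; lra.
have p0 : p 0 = y by rewrite /p addr0 -surjective_pairing.
pose u s := (iter n F (p s)).1; pose w s := (iter n F (p s)).2.
have cu (s : R) : {for s, continuous u}.
  have [K K0 lK] : exists2 K : R, 0 <= K & lip K ((fun q : R * R => q.1) \o iter n F).
    by apply: (lip_iter_F sp n ler01) => a b; rewrite mul1r lerDl.
  apply/cvgrPdist_le => e e0; have K1 : 0 < K + 1 by rewrite ltr_wpDl.
  have id_cvg : (fun r : R => r) @ s --> s by exact: cvg_id.
  move/cvgrPdist_le: id_cvg => /(_ (e / (K + 1)) (divr_gt0 e0 K1)) ns.
  near=> r; apply: (le_trans (lK (p s) (p r))); rewrite /= subrr normr0 addr0.
  rewrite (_ : y.1 + s - (y.1 + r) = s - r); last by ring.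
  have h : `|s - r| <= e / (K + 1) by near: r; exact: ns.
  have -> : e = e / (K + 1) * (K + 1) by rewrite divfK// gt_eqF.
  by have := normr_ge0 (s - r); nra.
have u1 : u 0 + 1 <= u 1.
  have [_] := cone_iter n (cp 0 1 ler01); rewrite /u /p /=; lra.
(* Clamping extends the graph continuously to the whole line. *)
pose cl (v : R) := Num.max (u 0) (Num.min v (u 0 + 1)).
have clb v : u 0 <= cl v <= u 0 + 1.
  by rewrite /cl le_max lexx /= ge_max lerDl ler01 /= ge_min lexx orbT.
have cl_id v : u 0 <= v <= u 0 + 1 -> cl v = v.
  by move=> /andP[h1 h2]; rewrite /cl min_l// max_r.
have cl_cont v : {for v, continuous cl}.
  apply: (@continuous_max _ _ (fun=> u 0) (fun v => Num.min v (u 0 + 1))).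
    exact: cvg_cst.
  apply: (@continuous_min _ _ (fun v => v) (fun=> u 0 + 1)).
    exact: cvg_id.
  exact: cvg_cst.
have exs v : exists s, 0 <= s /\ u s = cl v.
  have [|s] := @IVT R u 0 1 (cl v) ler01 (continuous_subspaceT cu) _.
    move: (clb v) => /andP[]; move: (cl v) => z h1 h2; rewrite ge_min le_max h1 /=.
    by apply/orP; right; lra.
  by rewrite in_itv /= => /andP[s0 _] us; exists s.
(* The chosen parameter [sg] need not be known to be continuous: the cone condition makes [w \o sg]
   Lipschitz directly. *)
have [sg Hsg] := choice exs.
have wu (v v' : R) : `|w (sg v) - w (sg v')| <= `|cl v - cl v'|.
  have [_ e1] := Hsg v; have [_ e2] := Hsg v'; rewrite -e1 -e2.
  have key (s s' : R) : s <= s' -> `|w s - w s'| <= `|u s - u s'|.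
    move=> /cp /(cone_iter n)[/andP[c1 c2] _].
    rewrite distrC (distrC (u s)) /w /u (ger0_norm c1) (ger0_norm (le_trans c1 c2)).
    exact: c2.
  have [h|/ltW h] := leP (sg v) (sg v'); first exact: key.
  by rewrite distrC (distrC (u _)); exact: key.
have cw v : {for v, continuous (fun v => w (sg v))}.
  apply/cvgrPdist_le => e e0; have := cl_cont v; move/cvgrPdist_le => /(_ e e0) nv.
  near=> r; apply: le_trans (wu v r) _; near: r; exact: nv.
pose X t := (curve n x t).1; pose Y t := (curve n x t).2.
have dX t := (d_curve sp sV flowV n x t).1.
have dY t := (d_curve sp sV flowV n x t).2.
have cX t : {for t, continuous X} := is_derive_continuous (dX t).
have cY t : {for t, continuous Y} := is_derive_continuous (dY t).
have XT (c : R) : X 0 <= c -> exists2 t, 0 <= t & X t = c.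
  move=> hc; pose T := (c - X 0) / (2 / 5 * 4^-1 ^+ n).
  have q0 : 0 < 2 / 5 * 4^-1 ^+ n :> R by rewrite mulr_gt0// exprn_gt0.
  have T0 : 0 <= T by rewrite divr_ge0 ?subr_ge0// ltW.
  have /andP[h _] := curve_disp sp sV flowV n x T0.
  rewrite {1}/T mulrC divfK ?gt_eqF// in h.
  have hX : c <= X T by move: h; rewrite /X P0; lra.
  have [|t] := @IVT R X 0 T c T0 (continuous_subspaceT cX) _.
    by rewrite ge_min le_max hc hX orbT.
  by rewrite in_itv /= => /andP[t0 _] e; exists t.
have XY (s t : R) : s <= t -> X s <= X t /\ Y t - Y s <= - (X t - X s).
  move=> st; split.
    by apply: derive_ge0_le st (fun r _ => dX r) _ => r _; rewrite ltW// (speed_gt0 sp sV).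
  have := derive_le_le st (fun r _ => dY r) (fun r _ => is_derive_opp (dX r)).
  rewrite -/(X s) -/(X t) => H; suff : Y t - Y s <= - X t - - X s by lra.
  apply: H => r _; have := slope_bounds sp sV (curve n x r).
  by have := speed_gt0 sp sV Phi n x r; set v := speed n x r; set sl := slope _; nra.
(* The window starts between 1 and 2 to the right of the image of x: the distance at least 1 makes
   the crossing time exponentially large, the distance at most 3 at its end keeps it at most
   exponential. *)
pose k := Num.floor (X 0 + 1 - u 0) + 1.
have /andP[k1 k2] : X 0 + 1 <= u 0 + k%:~R <= X 0 + 2.
  rewrite /k; have := floorD1_gt (X 0 + 1 - u 0); have := floor_le_tmp (X 0 + 1 - u 0).
  by rewrite intrD; set z := (Num.floor _)%:~R; lra.
have [tl tl0 Xtl] := XT (u 0 + k%:~R) ltac:(lra).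
have [tr tr0 Xtr] := XT (u 0 + k%:~R + 1) ltac:(lra).
have tlr : tl <= tr.
  by rewrite leNgt; apply/negP => /ltW /XY[]; rewrite Xtl Xtr; lra.
(* The graph starts at most 1 below the arc; over the window the arc drops by at least 1 and the
   graph does not descend below its start. *)
pose l := Num.floor (Y tl - w 0).
have /andP[l1 l2] : w 0 + l%:~R <= Y tl <= w 0 + l%:~R + 1.
  rewrite /l; have := floorD1_gt (Y tl - w 0); have := floor_le_tmp (Y tl - w 0).
  by rewrite intrD; set z := (Num.floor _)%:~R; lra.
pose f t := Y t - (w (sg (X t - k%:~R)) + l%:~R).
have cf t : {for t, continuous f}.
  apply: continuousB; first exact: cY.
  apply: continuousD; last exact: cvg_cst.
  apply: (@continuous_comp _ _ _ (fun t => X t - k%:~R) (fun v => w (sg v))); last exact: cw.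
  by apply: continuousB; [exact: cX|exact: cvg_cst].
have w0 v : 0 <= w (sg v) - w 0 <= cl v - u 0.
  have [s0 <-] := Hsg v.
  by have [] := cone_iter n (cp 0 (sg v) s0).
have ftl : 0 <= f tl.
  rewrite /f; have := w0 (X tl - k%:~R).
  by rewrite Xtl addrK cl_id; [lra|rewrite lexx lerDl ler01].
have ftr : f tr <= 0.
  rewrite /f; have := w0 (X tr - k%:~R); have [_] := XY _ _ tlr.
  by rewrite Xtl Xtr; lra.
have [|t] := @IVT R f tl tr 0 tlr (continuous_subspaceT cf) _.
  by rewrite ge_min ftr orbT le_max ftl.
rewrite in_itv /= => /andP[tlt ttr] ft0.
have [Xt1 _] := XY _ _ tlt; have [Xt2 _] := XY _ _ ttr.
rewrite Xtl in Xt1; rewrite Xtr in Xt2.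
pose s := sg (X t - k%:~R); have [s0 us] := Hsg (X t - k%:~R).
rewrite cl_id -/s in us; last by apply/andP; split; lra.
exists t, s; rewrite -/s in s0; split => //.
- exact: le_trans tlt.
- by rewrite -/(X t) (_ : (iter n F x).1 = X 0); [apply/andP; split; lra|rewrite /X P0].
- by rewrite -/(u s) (_ : (iter n F y).1 = u 0); [lra|rewrite /u p0].
have [i [j Hij]] := iter_F_unshift sp n k l.
have e : curve n x t = iter n F ((p s).1 + i%:~R, (p s).2 + j%:~R).
  rewrite Hij -/(u s) -/(w s) [LHS]surjective_pairing -/(X t) -/(Y t).
  by congr (_, _); [rewrite us subrK|move: ft0; rewrite /f -/s; lra].
by rewrite (iter_F_inj e) (periodic2_birkhoff sp sV).
Unshelve. all: by end_near. Qed.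

End Extremes.

(** * Growth of the determinant *)

Section Growth.
Variables (R : realType) (phi phi1 phi2 : R -> R) (gamma B : R).
Hypothesis sp : small_perturbation phi phi1 phi2 gamma B.
Variable V : R * R -> R * R.
Hypothesis sV : stable_unit_field (Fmap phi gamma) V.
Variable Phi : R -> R * R -> R * R.
Hypothesis flowV : flow_of V Phi.

Notation F := (Fmap phi gamma).
Notation birkhoff := (birkhoff phi phi1 gamma V).

Lemma cocycle_growth (x0 : R) : 0 < gamma -> phi x0 != phi 0 ->
  exists x, forall l : R -> R, l 0 = 0 ->
  (forall t : R, 0 <= t -> is_derive t 1 l
     (slope V (Phi t x) * V2x V (Phi t x) + V2y V (Phi t x))) ->
  forall T M : R, exists2 t : R, T < t & 1 <= t /\
    M <= l t - (phi x0 - phi 0) ^+ 2 / 244 / 16 * gamma ^+ 2 * ln t.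
Proof.
move=> g0 hx0; set D := (phi x0 - phi 0) ^+ 2.
have D0 : 0 < D by rewrite exprn_even_gt0//= subr_eq0.
have gB := gammaB_le sp; have gB0 := gammaB_ge0 sp.
pose e := gamma ^+ 2 * D / 244.
have e0 : 0 < e by rewrite divr_gt0// mulr_gt0// exprn_gt0.
have d0 : 0 < e / 2 by lra.
have d20 : 0 < e / 8 by lra.
have [x hx] := slow_point sp sV flowV d20.
exists x => l l0 dl T M.
(* 13 = 10 + 3/2 + 3/2 collects the variation along the cone curve, that of ln V1 and the distortion
   of the image arc. The Birkhoff sums at the crossing and at x differ by about (e/2 - e/8) n, and
   (e/16) ln t takes at most (e/16) (7 + 3 n) of it, since t <= 8 * 4^n. The bound by |T| gives t >
   T through t >= 2^n. *)
have [n nT] := exists_natr_gt (Num.max `|T| ((M + 13 + 7 * e / 16) / (e / 16))).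
have [nT1 nT2] : `|T| < n%:R /\ (M + 13 + 7 * e / 16) / (e / 16) < n%:R.
  by move: nT; rewrite gt_max => /andP[].
have n0 : (0 < n)%N by rewrite -(ltr_nat R) (le_lt_trans (normr_ge0 T)).
have dG : e / 2 < gamma ^+ 2 * D / 244 by rewrite -/e; lra.
have [y hy] := birkhoff_sup sp sV d0 dG n0.
have [t [s [t0 /andP[c1 c3] s0 ds bE]]] := crossing sp sV flowV x y n.
have cy : cone y (y.1 + s, y.2) by rewrite /cone /= subrr lexx /=; lra.
have := cone_birkhoff sp sV n cy; rewrite -bE => hb.
have := cocycle_birkhoff sp sV flowV n t0 l0 dl.
have := ln_V1_diff sp sV (Phi t x) x.
have /andP[e1 e2] := curve_disp sp sV flowV n x t0.
have t2 : 2 ^+ n <= t.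
  have : 1 <= 2^-1 ^+ n * t by exact: le_trans e2.
  by rewrite exprVn ler_pdivlMl ?exprn_gt0// mulr1.
have n2 : n%:R <= t by exact: le_trans (pow2_gt R n) t2.
have t1 : 1 <= t by apply: le_trans n2; rewrite ler1n.
have lnt : ln t <= 7 + 3 * n%:R.
  have t8 : t <= 8 * 4 ^+ n.
    have h : 2 / 5 * 4^-1 ^+ n * t <= 3 by exact: le_trans c3.
    have p4 : 0 < 4 ^+ n :> R by rewrite exprn_gt0.
    have : t = 5 / 2 * 4 ^+ n * (2 / 5 * 4^-1 ^+ n * t).
      by rewrite exprVn; field; rewrite gt_eqF.
    move=> ->; set q := 2 / 5 * _ * t in h *.
    by have := ler_wpM2l (ltW p4) h; lra.
  have t00 : 0 < t by lra.
  have : ln t <= ln (8 * 4 ^+ n) by rewrite ler_ln ?posrE// mulr_gt0// exprn_gt0.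
  rewrite lnM ?posrE ?exprn_gt0// lnXn// -[ln 4 *+ n]mulr_natl.
  have l8 : ln 8 <= 7 :> R by have := @ln_diff_le R 8 1 ltac:(lra) ltac:(lra); rewrite ln1; lra.
  have l4 : ln 4 <= 3 :> R by have := @ln_diff_le R 4 1 ltac:(lra) ltac:(lra); rewrite ln1; lra.
  have nn : 0 <= n%:R :> R by [].
  by have := ler_wpM2l nn l4; lra.
have hxn := hx n n0.
move: hb; rewrite !ler_norml => /andP[hb _] /andP[v1 _] /andP[w1 _].
exists t; first by rewrite (lt_le_trans _ n2)// (le_lt_trans (ler_norm T)).
split => //.
have g3 : 4 * (gamma * B) * ((iter n F (Phi t x)).1 - (iter n F x).1) <= 3 / 2.
  by move: c1 c3; set z := _ - _ => c1 c3; nra.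
have hG : D / 244 / 16 * gamma ^+ 2 * ln t <= e / 16 * (7 + 3 * n%:R).
  rewrite (_ : D / 244 / 16 * gamma ^+ 2 = e / 16); last by rewrite /e; ring.
  by rewrite ler_wpM2l//; lra.
have hn : M + 13 + 7 * e / 16 <= n%:R * (e / 16).
  by rewrite -ler_pdivrMr ?ltW//; lra.
move: ds hb; set z := (iter n F _).1 - _ => ds hb.
move: w1 g3; set z' := 4 * (gamma * B) * _ => w1 g3.
move: hy hxn hn hG; set N := n%:R; set L := ln (lam R); set bx := birkhoff n x in w1 *.
set cl := D / 244 / 16 * _ * _.
have Ne : 0 <= N * e by rewrite mulr_ge0 ?(ltW e0).
lra.
Qed.

Lemma limsup_growth (x0 : R) : 0 < gamma -> phi x0 != phi 0 ->
  exists a b : R * R -> R -> R, flow_differential V Phi a b /\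
   (ereal_sup [set limf_esup
      (fun t : R => (b x t * t `^ (- ((phi x0 - phi 0) ^+ 2 / 244 / 16 * gamma ^+ 2)))%:E)
      (+oo%R : set_system R) | x in [set: R * R]] = +oo)%E.
Proof.
move=> g0 hx0.
have [al Hal] := choice (fun xi => flow_cocycle sp sV flowV xi).
have [l H] := choice Hal.
exists al, (fun xi t => expR (l xi t)); split.
  by move=> t xi t0; have [_ _ _ _] := H xi; exact.
have [x hx] := cocycle_growth g0 hx0; have [_ l0 dl _ _] := H x.
have {}hx := hx _ l0 dl.
set c := (phi x0 - phi 0) ^+ 2 / 244 / 16 * gamma ^+ 2.
apply: ereal_supy; exists x => //; apply: eq_infty => r.
rewrite limf_esupE; apply: le_ereal_inf_tmp => _ [A [T [_ AT]] <-].
apply: le_ereal_sup_tmp.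
have [t Tt [t1 Mt]] := hx T (ln (Num.max r 1)).
have r0 : 0 < Num.max r 1 by rewrite lt_max ltr01 orbT.
exists (expR (l x t) * t `^ (- c))%:E; first by exists t => //; exact: AT.
rewrite lee_fin; apply: (@le_trans _ _ (Num.max r 1)); first by rewrite le_max lexx.
rewrite /powR gt_eqF ?(lt_le_trans ltr01 t1)// -expRD mulNr -[leLHS]lnK ?posrE//.
by rewrite ler_expR.
Qed.

End Growth.

(** * Generic observables *)

Section Generic.
Variable R : realType.
Implicit Types phi psi f : R -> R.

(** [sup] takes a default value on unbounded sets, hence the bound [M] among the hypotheses. *)
Lemma C2norm_ge f k (x M : R) : (k < 3)%N ->
  (forall y, `|derive1n k f y| <= M) -> `|derive1n k f x| <= C2norm f.
Proof.
move=> k3 fM; rewrite /C2norm.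
apply: le_trans (le_bigmax _ (fun k : 'I_3 => sup [set `|derive1n k f x| | x in [set: R]])
  (Ordinal k3)).
by apply: ub_le_sup; [exists M => _ [y _ <-]|exists x].
Qed.

Lemma C2norm_le f (M : R) : 0 <= M ->
  (forall k x, (k < 3)%N -> `|derive1n k f x| <= M) -> C2norm f <= M.
Proof.
move=> M0 fM; apply: bigmax_le => // k _; apply: ge_sup.
  by exists `|derive1n k f 0|, 0.
by move=> _ [x _ <-]; exact: fM.
Qed.

Lemma smooth_derive phi n (x : R) : smooth_zero_mean phi ->
  is_derive x 1 (derive1n n phi) (derive1n n.+1 phi x).
Proof. by case=> _ df _; split; [exact: df|rewrite derive1nS derive1E]. Qed.

Lemma smooth_bounded phi : smooth_zero_mean phi -> exists M : R, forall x, `|phi x| <= M.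
Proof.
move=> sphi; have [pf _ _] := sphi; apply: periodic_bounded => // x.
exact: (is_derive_continuous (smooth_derive 0 x sphi)).
Qed.

(** Taking B = 1 for the whole ball makes the range of gamma independent of phi. *)
Lemma ball_small_perturbation phi (gamma : R) : C2_unit_ball phi ->
  0 <= gamma <= 50^-1 ->
  small_perturbation phi (derive1n 1 phi) (derive1n 2 phi) gamma 1.
Proof.
move=> [sphi n1] /andP[g0 g1]; have [B B0 spB] := small_perturbation_exists sphi.
(* The instance at gamma = 0 supplies the finiteness that [C2norm_ge] requires. *)
have [p d1 d2 b1 b2 _ _] := spB 0 (lexx _) ltac:(rewrite mul0r; lra).
split=> // [x|x|]; last by rewrite mulr1.
- by apply: le_trans (ltW n1); apply: (C2norm_ge _ _ b1).
- by apply: le_trans (ltW n1); apply: (C2norm_ge _ _ b2).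
Qed.

Lemma zero_mean_constant phi : smooth_zero_mean phi ->
  (forall x, phi x = phi 0) -> phi = (fun=> 0).
Proof.
move=> [_ _ i0] cphi; apply/funext => x; rewrite cphi.
move: i0; under eq_integral do rewrite cphi.
rewrite integral_cst//= lebesgue_measure_itv /= lte_fin ltr01 sube0 mule1.
by case.
Qed.

Definition wave (e : R) (x : R) : R := e * sin (pi *+ 2 * x).

Lemma is_derive_trig (a b x : R) :
  is_derive x 1 (fun x => a * sin (pi *+ 2 * x) + b * cos (pi *+ 2 * x))
    (- (b * (pi *+ 2)) * sin (pi *+ 2 * x) + a * (pi *+ 2) * cos (pi *+ 2 * x)).
Proof.
have dl := is_derive_scale (pi *+ 2) (is_derive_idfun x).
have ds := is_derive_compose (is_derive_sin (pi *+ 2 * x)) dl.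
have dc := is_derive_compose (is_derive_cos (pi *+ 2 * x)) dl.
by apply: (is_derive_eq (is_derive_add (is_derive_scale a ds) (is_derive_scale b dc))); ring.
Qed.

Lemma derive1n_trig n (a b : R) : exists a' b', derive1n n
  (fun x => a * sin (pi *+ 2 * x) + b * cos (pi *+ 2 * x)) =
  (fun x => a' * sin (pi *+ 2 * x) + b' * cos (pi *+ 2 * x)).
Proof.
elim: n => [|n [a' [b' ih]]]; first by exists a, b.
exists (- (b' * (pi *+ 2))), (a' * (pi *+ 2)); rewrite derive1nS ih.
by apply/funext => x; rewrite derive1E; have [_ ->] := is_derive_trig a' b' x.
Qed.

Lemma waveE (e : R) :
  wave e = (fun x => e * sin (pi *+ 2 * x) + 0 * cos (pi *+ 2 * x)).
Proof. by apply/funext => x; rewrite mul0r addr0. Qed.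

Lemma wave_smooth (e : R) : smooth_zero_mean (wave e).
Proof.
split=> [x|n x|].
- by rewrite /wave mulrDr mulr1 sinD2pi.
- rewrite waveE; have [a' [b' ->]] := derive1n_trig n e 0.
  by have [] := is_derive_trig a' b' x.
have p0 : pi *+ 2 != 0 :> R by rewrite gt_eqF// mulrn_wgt0// pi_gt0.
pose P x : R := - e / (pi *+ 2) * cos (pi *+ 2 * x).
have dP (x : R) : is_derive x 1 P (wave e x).
  have dc := is_derive_compose (is_derive_cos (pi *+ 2 * x)) (is_derive_scale (pi *+ 2) (is_derive_idfun x)).
  apply: (is_derive_eq (is_derive_scale _ dc)); rewrite /wave.
  by move: p0; generalize (pi *+ 2 : R) => w p0; field.
have cP (x : R) : {for x, continuous P} := is_derive_continuous (dP x).
rewrite (@continuous_FTC2 _ _ P) ?ltr01//.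
- by rewrite /P mulr1 mulr0 cos2pi cos0 subee.
- apply: continuous_subspaceT => x; rewrite waveE.
  exact: is_derive_continuous (is_derive_trig e 0 x).
- split=> [x _||]; first by have [] := dP x.
  + exact: cvg_at_right_filter (cP 0).
  + exact: cvg_at_left_filter (cP 1).
- by move=> x _; rewrite derive1E; have [] := dP x.
Qed.

Lemma wave_C2norm (e : R) : 0 <= e -> C2norm (wave e) <= e * (1 + pi *+ 2) ^+ 2.
Proof.
move=> e0; have p0 : 0 <= pi *+ 2 :> R by rewrite mulrn_wge0// pi_ge0.
have bd (a b c x : R) : `|a| + `|b| <= c ->
    `|a * sin (pi *+ 2 * x) + b * cos (pi *+ 2 * x)| <= c.
  move=> h; apply: le_trans h; apply: (le_trans (ler_normD _ _)).
  by rewrite !normrM; apply: lerD; rewrite ler_piMr ?sin_max ?cos_max.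
have d1 (a b : R) : derive1 (fun x => a * sin (pi *+ 2 * x) + b * cos (pi *+ 2 * x)) =
    (fun x => - (b * (pi *+ 2)) * sin (pi *+ 2 * x) + a * (pi *+ 2) * cos (pi *+ 2 * x)).
  by apply/funext => x; rewrite derive1E; have [_ ->] := is_derive_trig a b x.
apply: C2norm_le; first by rewrite mulr_ge0// exprn_ge0// addr_ge0.
move=> k x k3; rewrite waveE; set w := pi *+ 2 in p0 bd d1 *.
have ew : 0 <= e * w by rewrite mulr_ge0.
have eww : 0 <= e * w * w by rewrite mulr_ge0.
case: k k3 => [|[|[|//]]] _.
- rewrite derive1n0; apply: bd; rewrite normr0 addr0 ger0_norm//; nra.
- rewrite derive1n1 d1; apply: bd; rewrite mul0r oppr0 normr0 add0r ger0_norm//; nra.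
- rewrite derive1nS derive1n1 !d1; apply: bd.
  rewrite !mul0r oppr0 mul0r normr0 addr0 normrN ger0_norm//; nra.
Qed.

(** Open, because a uniform change below half of |phi x - phi 0| cannot make the two values equal;
    dense, because the only constant of zero mean is 0, which a small sine wave approximates. *)
Lemma generic_nonconstant :
  generic [set phi : R -> R | C2_unit_ball phi /\ exists x, phi x != phi 0].
Proof.
exists [set phi : R -> R | C2_unit_ball phi /\ exists x, phi x != phi 0].
split=> // [phi []//|phi [bphi [x hx]]|phi bphi e e0].
- pose d := `|phi x - phi 0|.
  have d0 : 0 < d by rewrite normr_gt0 subr_eq0.
  exists (d / 2); first by rewrite divr_gt0.
  move=> psi bpsi dpsi; split => //; exists x; apply/eqP => e.
  have [M1 H1] := smooth_bounded bphi.1; have [M2 H2] := smooth_bounded bpsi.1.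
  have close y : `|psi y - phi y| < d / 2.
    apply: le_lt_trans dpsi; apply: (@C2norm_ge (psi \- phi) 0 y (M2 + M1)) => // z /=.
    by apply: (le_trans (ler_normB _ _)); exact: lerD.
  have : d <= `|psi x - phi x| + `|psi 0 - phi 0|.
    rewrite /d (_ : phi x - phi 0 = (psi 0 - phi 0) - (psi x - phi x)); last by rewrite e; ring.
    by rewrite [leRHS]addrC; exact: ler_normB.
  by have := close x; have := close 0; lra.
have [[x hx]|no] := pselect (exists x, phi x != phi 0).
  exists phi; first by split => //; exists x.
  apply: le_lt_trans e0; apply: C2norm_le => // k y _.
  rewrite (_ : phi \- phi = cst 0); last by apply/funext => z /=; rewrite subrr.
  suff -> : derive1n k (cst 0 : R -> R) = cst 0 by rewrite normr0.
  by elim: k => [//|k ih]; rewrite derive1nS ih; apply/funext => z; rewrite derive1_cst.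
have phi0 : phi = (fun=> 0).
  apply: zero_mean_constant bphi.1 _ => x.
  by have [//|h] := eqVneq (phi x) (phi 0); case: no; exists x.
pose w : R := (1 + pi *+ 2) ^+ 2.
have w0 : 0 < w by rewrite exprn_gt0// addr_gt0// mulrn_wgt0// pi_gt0.
(* The wave must be both [e]-close to 0 and inside the unit ball. *)
pose h := Num.min e 1 / (2 * w).
have m0 : 0 < Num.min e 1 by rewrite lt_min e0 ltr01.
have h0 : 0 < h by rewrite divr_gt0// mulr_gt0.
have hw : C2norm (wave h) < Num.min e 1.
  apply: (le_lt_trans (wave_C2norm (ltW h0))); rewrite -/w.
  have -> : h * w = Num.min e 1 / 2 by rewrite /h; field; rewrite gt_eqF.
  by lra.
move: hw; rewrite lt_min => /andP[hwe hw1].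
exists (wave h); last first.
  rewrite (_ : wave h \- phi = wave h)//.
  by apply/funext => x; rewrite /= phi0 subr0.
split; first by split => //; exact: wave_smooth.
exists 4^-1; rewrite /wave mulr0 sin0 mulr0.
rewrite (_ : pi *+ 2 * 4^-1 = pi / 2); last by rewrite -mulr_natl; field.
by rewrite sin_pihalf mulr1 gt_eqF.
Qed.

End Generic.

Theorem lemma5p16 (R : realType) :
  (forall phi : R -> R, smooth_zero_mean phi ->
    exists gamma0 C0 bstar tstar : R,
      [/\ 0 < gamma0, 0 < C0, 0 < bstar & 0 < tstar] /\
      forall (gamma : R) (V : R * R -> R * R) (Phi : R -> R * R -> R * R),
        0 <= gamma < gamma0 ->
        stable_unit_field (Fmap phi gamma) V ->
        flow_of V Phi ->
        exists a b : R * R -> R -> R,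
          flow_differential V Phi a b /\
          forall (xi : R * R) (t : R), tstar <= t ->
            [/\ C0 * t `^ (- (bstar * gamma)) <= b xi t,
                b xi t <= C0^-1 * t `^ (bstar * gamma) &
                `|a xi t| <= gamma * C0^-1 * t `^ (1 + bstar * gamma)])
  /\
  (exists2 gamma1 : R, 0 < gamma1 &
    generic [set phi : R -> R | exists2 cstar : R, 0 < cstar &
      forall (gamma : R) (V : R * R -> R * R) (Phi : R -> R * R -> R * R),
        0 < gamma < gamma1 ->
        stable_unit_field (Fmap phi gamma) V ->
        flow_of V Phi ->
        exists a b : R * R -> R -> R,
          flow_differential V Phi a b /\
          (ereal_sup [set limf_esup
              (fun t : R => (b x t * t `^ (- (cstar * gamma ^+ 2)))%:E) (+oo%R : set_system R)
            | x in [set: R * R]] = +oo)%E]).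
Proof.
split; first by move=> phi; exact: smooth_flow_bounds.
exists 50^-1; first by rewrite invr_gt0.
have [U [Uball Uopen Udense Usub]] := generic_nonconstant R.
exists U; split=> // phi /Usub[bphi [x0 hx0]].
(* 244 comes from the gap between the mean of ln kap and ln lam, and 16 from the share of this gap
   per unit of ln t. *)
exists ((phi x0 - phi 0) ^+ 2 / 244 / 16).
  by rewrite !divr_gt0// exprn_even_gt0//= subr_eq0.
move=> gamma V Phi /andP[g0 g1] sV flowV.
have g01 : 0 <= gamma <= 50^-1 by rewrite (ltW g0) (ltW g1).
exact: (limsup_growth (ball_small_perturbation bphi g01) sV flowV g0 hx0).
Qed.
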